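(* Fix $d\ge3$ and $\lambda\ge0$. Let $\mathcal X=\{\mathcal X_n\}$ be any prior supported on the unit sphere in $\mathbb R^n$. Let $T=\lambda x^{\otimes d}+W$ be a spiked tensor drawn from $\mathrm{WT}(d,\lambda,\mathcal X)$. With probability $1-o(1)$ as $n\to\infty$ we have $$\|T\|\ge L_d(\lambda)-o(1),$$ where $$L_d(\lambda)=\max_{m\in[0,1]}m^d\left(\lambda+\sqrt{\frac{2d}{d-1}}\sqrt{M(1+M)}\right),\qquad M=M(m)=(d-1)\frac{1-m^2}{m^2}.$$
   Context: Wigner tensor: for integers $d\ge2$, $n\ge1$, $\mathrm{WT}(d)=\mathrm{WT}_n(d)$ is the law of the symmetric tensor $W\in(\mathbb R^n)^{\otimes d}$ obtained by drawing $W'\in\mathbb R^{n^d}$ with i.i.d. $\mathcal N(0,2/n)$ entries and averaging it over all $d!$ permutations of the indices. Spiked model: a prior $\mathcal X=\{\mathcal X_n\}$ is a family of distributions on unit vectors of $\mathbb R^n$; $\mathrm{WT}(d,\lambda,\mathcal X)$ is the law of $T=\lambda x^{\otimes d}+W$ with $x\sim\mathcal X_n$ and $W\sim\mathrm{WT}_n(d)$ independent, where $\lambda$ does not depend on $n$. Injective norm: $\|T\|=\max_{\|v\|=1}\langle T,v^{\otimes d}\rangle$ (maximum over unit vectors $v\in\mathbb R^n$; entrywise inner product). The conclusion means that there is a deterministic sequence $\varepsilon_n\to0$ with $\Pr[\|T\|\ge L_d(\lambda)-\varepsilon_n]\to1$. In the definition of $L_d$, the expression being maximized is interpreted at $m=0$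 by continuity (its value there is $0$). *)

(* Defs.v *)
From HB Require Import structures.
From mathcomp Require Import all_boot all_order all_algebra all_fingroup.
From mathcomp Require Import all_classical all_reals all_analysis.
From mathcomp Require Import measurable_realfun.
From mathcomp Require Import ring lra zify.

Set Implicit Arguments.
Unset Strict Implicit.
Unset Printing Implicit Defensive.

Import Order.TTheory GRing.Theory Num.Theory.
Import numFieldNormedType.Exports.

Local Open Scope classical_set_scope.
Local Open Scope ring_scope.

Section iid.
Context (disp : measure_display) (T : measurableType disp) (R : realType).

Definition cons_pair (k : nat) (p : T * k.-tuple T) : k.+1.-tuple T :=
  [tuple of p.1 :: p.2].

Lemma measurable_cons_pair k : measurable_fun setT (@cons_pair k).
Proof. exact: measurable_cons. Qed.

HB.instance Definition _ k :=
  isMeasurableFun.Build _ _ _ _ (@cons_pair k) (@measurable_cons_pair k).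

(* Law of k independent draws from P; see [iid_prod] below. *)
Fixpoint iid (P : probability T R) (k : nat) : probability (k.-tuple T) R :=
  match k with
  | 0 => \d_([tuple] : 0.-tuple T)
  | k'.+1 => distribution (P \x iid P k')%E (@cons_pair k')
  end.

Lemma iid_prod (P : probability T R) k (A : 'I_k -> set T) :
  (forall i, measurable (A i)) ->
  iid P k [set t | forall i, A i (tnth t i)] = (\prod_(i < k) P (A i))%E.
Proof.
elim: k A => [|k IH] A mA.
  by rewrite big_ord0 /= diracE mem_set// => -[].
rewrite big_ord_recl -IH => [|i]; last exact: mA.
have mB : measurable
    [set t : k.-tuple T | forall i, A (lift ord0 i) (tnth t i)].
  rewrite (_ : mkset _ = \bigcap_(i in [set: 'I_k])
      ((fun t : k.-tuple T => tnth t i) @^-1` A (lift ord0 i))).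
    apply: fin_bigcap_measurable => // i _.
    by rewrite -[X in measurable X]setTI; exact: measurable_tnth.
  by apply/seteqP; split => t /= At i; [move=> _|]; exact: At.
rewrite -(product_measure1E P (iid P k) (mA ord0) mB) /distribution /pushforward.
congr (product_measure1 P _ _); apply/seteqP; split => -[x t] /=.
  move=> At; split; first by have := At ord0.
  by move=> i; have := At (lift ord0 i); rewrite tnthS.
by move=> [A0 At] i; case: (unliftP ord0 i) => [j ->|->//]; rewrite tnthS.
Qed.

End iid.

Section spiked_tensor.
Context {R : realType}.

Definition multi_index (d n : nat) := {ffun 'I_d -> 'I_n}.

(* Order-d tensors on R^n, as tuples of n ^ d reals so as to inherit the
   product sigma-algebra of k.-tuple. *)
Definition tensor (d n : nat) := #|{: multi_index d n}|.-tuple R.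

HB.instance Definition _ d n := Measurable.on (tensor d n).

Definition entry d n (T : tensor d n) (i : multi_index d n) : R :=
  tnth T (enum_rank i).

Definition mk_tensor d n (f : multi_index d n -> R) : tensor d n :=
  [tuple f (enum_val k) | k < #|{: multi_index d n}|].

Lemma entry_mk_tensor d n (f : multi_index d n -> R) i :
  entry (mk_tensor f) i = f i.
Proof. by rewrite /entry tnth_mktuple enum_rankK. Qed.

Definition tensor_inner d n (S T : tensor d n) : R :=
  \sum_(i : multi_index d n) entry S i * entry T i.

Definition tensor_pow d n (v : n.-tuple R) : tensor d n :=
  mk_tensor (fun i => \prod_(k < d) tnth v (i k)).

Definition unit_sphere n : set (n.-tuple R) :=
  [set v | \sum_(i < n) tnth v i ^+ 2 = 1].
Arguments unit_sphere : clear implicits.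

(* A maximum for 0 < n: see [inj_norm_max] below. *)
Definition inj_norm d n (T : tensor d n) : R :=
  sup [set tensor_inner T (tensor_pow d v) | v in unit_sphere n].

Definition symmetrize d n (T : tensor d n) : tensor d n :=
  mk_tensor (fun i => (d`!%:R)^-1 *
    \sum_(s : {perm 'I_d}) entry T [ffun k => i (s k)]).

Definition spike d n (lambda : R) (xW : n.-tuple R * tensor d n) : tensor d n :=
  mk_tensor (fun i => lambda * entry (tensor_pow d xW.1) i + entry xW.2 i).

Lemma measurable_entry d n (i : multi_index d n) :
  measurable_fun setT (fun T : tensor d n => entry T i).
Proof. exact: measurable_tnth. Qed.

Lemma measurable_mk_tensor disp (S : measurableType disp) d n
    (f : S -> multi_index d n -> R) :
  (forall i, measurable_fun setT (f ^~ i)) ->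
  measurable_fun setT (fun s => mk_tensor (f s)).
Proof.
move=> mf; apply/measurable_fun_tnthP => k.
rewrite (_ : _ \o _ = f ^~ (enum_val k)); first exact: mf.
by apply/funext => s; rewrite /= tnth_mktuple.
Qed.

Lemma measurable_symmetrize d n : measurable_fun setT (@symmetrize d n).
Proof.
apply: measurable_mk_tensor => i; apply: measurable_funM => //.
by apply: measurable_sum => s; exact: measurable_entry.
Qed.

Lemma measurable_spike d n lambda : measurable_fun setT (@spike d n lambda).
Proof.
apply: measurable_mk_tensor => i; apply: measurable_funD; last first.
  by apply: (measurableT_comp (measurable_entry i)); exact: measurable_snd.
apply: measurable_funM => //.
under eq_fun do rewrite entry_mk_tensor.
apply: measurable_prod => k _; apply: (measurableT_comp (measurable_tnth _)).
exact: measurable_fst.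
Qed.

HB.instance Definition _ d n := isMeasurableFun.Build _ _ _ _
  (@symmetrize d n) (@measurable_symmetrize d n).

HB.instance Definition _ d n lambda := isMeasurableFun.Build _ _ _ _
  (@spike d n lambda) (@measurable_spike d n lambda).

(* [normal_prob] is stated on [measurableTypeR R], whose display differs from
   that of [R]; the two have the same (Borel) measurable sets. *)
Definition borel_id (x : measurableTypeR R) : R := x.

Lemma measurable_borel_id : measurable_fun setT borel_id.
Proof. exact: measurable_id. Qed.

HB.instance Definition _ :=
  isMeasurableFun.Build _ _ _ _ borel_id measurable_borel_id.

(* [normal_prob] takes the standard deviation, not the variance. *)
Definition gaussian (v : R) : probability R R :=
  distribution (normal_prob 0 (Num.sqrt v)) borel_id.

Definition gaussian_tensor d n : probability (tensor d n) R :=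
  iid (gaussian (2 / n%:R)) #|{: multi_index d n}|.

Definition wigner d n : probability (tensor d n) R :=
  distribution (gaussian_tensor d n) (@symmetrize d n).

Definition spiked_wigner d n (lambda : R) (X : probability (n.-tuple R) R) :
    probability (tensor d n) R :=
  distribution (X \x wigner d n)%E (@spike d n lambda).

(* With x / 0 = 0, [L_objective d lambda 0] is 0 for d > 0, which is its value
   by continuity when d >= 3. *)
Definition L_objective (d : nat) (lambda m : R) : R :=
  let M := (d%:R - 1) * ((1 - m ^+ 2) / m ^+ 2) in
  m ^+ d * (lambda + Num.sqrt (2 * d%:R / (d%:R - 1)) * Num.sqrt (M * (1 + M))).

(* A maximum for d >= 3: see [L_max] below. *)
Definition L (d : nat) (lambda : R) : R :=
  sup [set L_objective d lambda m | m in `[0, 1]%classic].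

End spiked_tensor.
Arguments tensor : clear implicits.
Arguments unit_sphere {R} n.
Arguments spiked_wigner {R} d n lambda X.

Lemma sup_max (R : realType) (A : set R) (c : R) :
  A c -> ubound A c -> sup A = c.
Proof.
move=> Ac ub; apply/eqP; rewrite eq_le; apply/andP; split.
  by apply: ge_sup => //; exists c.
by apply: ub_le_sup => //; exists c.
Qed.

Lemma continuous_sum (R : realType) (T : topologicalType) (I : Type)
    (s : seq I) (h : I -> T -> R) : (forall i, continuous (h i)) ->
  continuous (fun t => \sum_(i <- s) h i t).
Proof.
move=> ch t; elim: s => [|i s IH].
  by rewrite /continuous_at big_nil; under eq_fun do rewrite big_nil; exact: cvg_cst.
rewrite /continuous_at big_cons; under eq_fun do rewrite big_cons.
by apply: cvgD; [exact: ch|exact: IH].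
Qed.

Lemma continuous_prod (R : realType) (T : topologicalType) (I : Type)
    (s : seq I) (h : I -> T -> R) : (forall i, continuous (h i)) ->
  continuous (fun t => \prod_(i <- s) h i t).
Proof.
move=> ch t; elim: s => [|i s IH].
  by rewrite /continuous_at big_nil; under eq_fun do rewrite big_nil; exact: cvg_cst.
rewrite /continuous_at big_cons; under eq_fun do rewrite big_cons.
by apply: cvgM; [exact: ch|exact: IH].
Qed.

Lemma inj_norm_max (R : realType) d n (T : tensor R d n) : (0 < n)%N ->
  exists2 v, unit_sphere n v &
    inj_norm T = tensor_inner T (tensor_pow d v) /\
    forall u, unit_sphere n u ->
      tensor_inner T (tensor_pow d u) <= tensor_inner T (tensor_pow d v).
Proof.
case: n T => // n T _.
pose tup (v : 'rV[R]_n.+1) : n.+1.-tuple R := [tuple v ord0 i | i < n.+1].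
pose S := [set v : 'rV[R]_n.+1 | \sum_i v ord0 i ^+ 2 = 1].
have tupS v : S v -> unit_sphere n.+1 (tup v).
  by rewrite /S /unit_sphere /= => <-; apply: eq_bigr => i _; rewrite tnth_mktuple.
have tupP u : unit_sphere n.+1 u -> exists2 v, S v & u = tup v.
  move=> Su; exists (\row_i tnth u i).
    by rewrite /S /= -[RHS]Su; apply: eq_bigr => i _; rewrite mxE.
  by apply: eq_from_tnth => i; rewrite tnth_mktuple mxE.
have cc i : continuous (fun v : 'rV[R]_n.+1 => v ord0 i).
  exact: coord_continuous.
have [|||c cS cmax] := @EVT_max_rV R n.+1
    (fun v => tensor_inner T (tensor_pow d (tup v))) S.
- exists (delta_mx ord0 ord0) => /=.
  rewrite /S /= (bigD1 ord0)//= big1 ?addr0 ?mxE ?eqxx ?expr1n// => i i0.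
  by rewrite mxE (negbTE i0) expr0n.
- apply: bounded_closed_compact.
    exists 1; split => // M M1 v Sv; apply: (le_trans _ (ltW M1)).
    rewrite [leLHS]mx_normrE; apply: bigmax_le => // -[i j] _ /=.
    rewrite ord1 -(@ler_pXn2r _ 2) ?nnegrE// expr1n real_normK ?num_real//.
    rewrite -[leRHS]Sv (bigD1 j)//= lerDl.
    by apply: sumr_ge0 => k _; exact: sqr_ge0.
  apply: (@preimage_closed _ _ (fun v : 'rV[R]_n.+1 => \sum_i v ord0 i ^+ 2) [set 1]); last exact: closed_eq.
  suff cS : continuous (fun v : 'rV[R]_n.+1 => \sum_i v ord0 i ^+ 2).
    by move=> v _; exact: cS.
  apply: continuous_sum => i w.
  rewrite /continuous_at expr2; under eq_fun do rewrite expr2.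
  exact: (cvgM (cc i w) (cc i w)).
- apply: continuous_subspaceT; apply: continuous_sum => i.
  have ct : continuous (fun v => entry (tensor_pow d (tup v)) i).
    under eq_fun do rewrite entry_mk_tensor.
    apply: continuous_prod => k.
    by under eq_fun do rewrite tnth_mktuple; exact: cc.
  by move=> v; exact: (cvgM (cvg_cst _) (ct v)).
exists (tup c); first by apply: tupS; rewrite -inE.
have ub u : unit_sphere n.+1 u -> tensor_inner T (tensor_pow d u) <=
    tensor_inner T (tensor_pow d (tup c)).
  by move=> /tupP[v Sv ->]; apply: cmax; rewrite inE.
split => //; apply: sup_max; last by move=> _ [u Su <-]; exact: ub.
by exists (tup c) => //; apply: tupS; rewrite -inE.
Qed.

Lemma L_max (R : realType) d (lambda : R) : (3 <= d)%N ->
  exists2 m, m \in `[0, 1] & L d lambda = L_objective d lambda m /\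
    forall t, t \in `[0, 1] -> L_objective d lambda t <= L_objective d lambda m.
Proof.
move=> d3; set f := L_objective d lambda.
pose g (m : R) := lambda * m ^+ d + Num.sqrt (2 * d%:R / (d%:R - 1)) *
  (m ^+ (d - 2) * Num.sqrt ((d%:R - 1) * (1 - m ^+ 2) *
     (m ^+ 2 + (d%:R - 1) * (1 - m ^+ 2)))).
have fg m : 0 <= m -> f m = g m.
  rewrite le_eqVlt => /predU1P[<-|m0].
    rewrite /f /L_objective /g !expr0n; have -> : (d == 0)%N = false by lia.
    have -> : (d - 2 == 0)%N = false by lia.
    by rewrite !mulr0n !(mul0r, mulr0) addr0.
  rewrite /f /L_objective /g mulrDr; congr (_ + _); first exact: mulrC.
  rewrite mulrCA /=; congr (_ * _).
  rewrite -{1}(@subnK 2 d) ?exprD; last by lia.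
  rewrite -[LHS]mulrA; congr (_ * _).
  have m0' : m != 0 by rewrite gt_eqF.
  have m2 : 0 < m ^+ 2 by rewrite exprn_gt0.
  rewrite [X in Num.sqrt X](_ : _ = (m ^- 2) ^+ 2 * ((d%:R - 1) * (1 - m ^+ 2) *
     (m ^+ 2 + (d%:R - 1) * (1 - m ^+ 2)))); last by field.
  by rewrite sqrtrM ?sqr_ge0// sqrtr_sqr gtr0_norm ?invr_gt0// mulVKf// gt_eqF.
have [||m m01 mmax] := @EVT_max R g 0 1 => //.
  apply: continuous_subspaceT.
  have cX k : continuous (fun m : R => m ^+ k) by exact: exprn_continuous.
  have ca : continuous (fun m : R => (d%:R - 1) * (1 - m ^+ 2)).
    move=> m; apply: cvgM; first exact: cvg_cst.
    by apply: cvgB; [exact: cvg_cst|exact: cX].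
  move=> m; apply: cvgD; first by apply: cvgM; [exact: cvg_cst|exact: cX].
  apply: cvgM; first exact: cvg_cst.
  apply: cvgM; first exact: cX.
  apply: (@continuous_comp _ _ _ (fun m : R => (d%:R - 1) * (1 - m ^+ 2) *
     (m ^+ 2 + (d%:R - 1) * (1 - m ^+ 2)))); last exact: sqrt_continuous.
  by apply: cvgM; [exact: ca|apply: cvgD; [exact: cX|exact: ca]].
have ub t : t \in `[0, 1] -> f t <= f m.
  move=> t01; rewrite !fg; first exact: mmax.
    by move: m01; rewrite in_itv/= => /andP[].
  by move: t01; rewrite in_itv/= => /andP[].
exists m => //; split => //; apply: sup_max; first by exists m.
by move=> _ [t t01 <-]; exact: ub.
Qed.

(* Main.v *)
From HB Require Import structures.
Require Import Defs.
From mathcomp Require Import all_boot all_order all_algebra perm.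
From mathcomp Require Import all_classical all_reals all_analysis.
From mathcomp Require Import measurable_realfun ring lra zify.

Import Order.TTheory GRing.Theory Num.Theory.
Import numFieldNormedType.Exports.

Local Open Scope classical_set_scope.
Local Open Scope ring_scope.

Set Implicit Arguments.
Unset Strict Implicit.
Unset Printing Implicit Defensive.

(* By Fubini it suffices to bound the norm from below for every fixed unit x. On
   v = m x + sqrt(1 - m^2) u with u a unit vector orthogonal to x, the terms of
   <W, v^d> of degree one and two in u form a random field
   a <g, u> + b <u, G u> with independent Gaussian g and G; all remaining terms
   are, for given g and G, a Gaussian of variance at most 2 / n, hence
   negligible at a u chosen from g and G. The maximum of the field over u is at
   least sqrt(2 a^2 + 4 b^2) - o(1), which is the noise part of the objective
   defining L_d. This is shown by a Krylov-type recursion: take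
   u = c g / |g| + s u' with u' orthogonal to g; by rotation invariance the
   restriction of the field to u' is again of the same type, in one dimension
   less and with sqrt(2 a^2 + 4 b^2) multiplied by s^2, while the direction
   g / |g| contributes c^2 times it. After K steps the fraction 1 - s^(2 K) has
   been collected.

   Rotation invariance of the Gaussian measure reduces to the plane, where a
   rotation is a product of shears, which preserve Lebesgue measure. *)

(** * Rotation invariance in the plane *)

(** Entries have variance [2 / n], so [|g|^2] is close to 2: asymptotically the linear part alone
    reaches [sqrt 2 a], the quadratic part alone [2 b]. Writing [r = sqrt(2 a^2 + 4 b^2)],
    [a = c r / sqrt 2] and [b = s r / 2] with [c^2 + s^2 = 1] makes the recursion self-similar. On
    [c g / |g| + s u'] the cross terms of [b <u, G u>] form a linear field in [u'] with coefficient
    [sqrt 2 c s b = c (s^2 r) / sqrt 2], and what is left of the quadratic part has coefficient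
    [s^2 b = s (s^2 r) / 2]: the pair [(c, s)] stays, [r] becomes [s^2 r]. The direction [g / |g|]
    gains [a c |g|], about [c^2 r].

    Conditioning is replaced by product measures: each Gaussian array is exhibited as the
    measure-preserving image of independent arrays, and what is chosen from one factor is a constant
    on the sections over it. Symmetrizing the noise does not change its pairing with [v^d], so all
    arguments concern arrays with independent entries, where orthonormality of coefficient vectors
    is all there is to check. *)

Section density.
Local Open Scope ereal_scope.
Context d (T : measurableType d) (R : realType).
Variables (m nu : {measure set T -> \bar R}) (g : T -> R).
Hypotheses (mg : measurable_fun setT g) (g0 : forall x, (0 <= g x)%R).
Hypothesis nuE : forall A, measurable A -> nu A = \int[m]_(x in A) (g x)%:E.

Import HBNNSimple.

Let density_indic A : measurable A ->
  \int[nu]_x (\1_A x)%:E = \int[m]_x ((\1_A x)%:E * (g x)%:E).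
Proof.
move=> mA; rewrite integral_indic// setIT nuE// integral_mkcond.
by apply: eq_integral => x _; rewrite epatch_indic muleC.
Qed.

Let density_nnsfun (h : {nnsfun T >-> R}) :
  \int[nu]_x (h x)%:E = \int[m]_x ((h x)%:E * (g x)%:E).
Proof.
under [LHS]eq_integral do rewrite fimfunE -fsumEFin//.
rewrite [LHS]ge0_integral_fsum//; last 2 first.
  - by move=> r; exact/measurable_EFinP/measurableT_comp.
  - by move=> n x _; rewrite EFinM nnfun_muleindic_ge0.
under [RHS]eq_integral.
  move=> x xD; rewrite fimfunE -fsumEFin// ge0_mule_fsuml; last first.
    by move=> r; rewrite EFinM nnfun_muleindic_ge0.
  over.
rewrite [RHS]ge0_integral_fsum//; last 2 first.
  - move=> r; apply: emeasurable_funM; last exact/measurable_EFinP.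
    by apply/measurable_EFinP/measurableT_comp => //.
  - move=> n x _; rewrite EFinM mule_ge0// ?lee_fin//.
    exact: nnfun_muleindic_ge0.
apply: eq_fsbigr => r; rewrite inE => -[x _ <-].
under eq_integral do rewrite EFinM.
under [RHS]eq_integral do rewrite EFinM -muleA.
have m1 : measurable_fun setT (fun y => (\1_(h @^-1` [set h x]) y)%:E : \bar R).
  exact/measurable_EFinP/measurable_indic.
have m2 := emeasurable_funM m1 ((measurable_EFinP _ _).2 mg).
have i0 y : 0 <= (\1_(h @^-1` [set h x]) y)%:E :> \bar R by rewrite lee_fin.
rewrite (ge0_integralZl _ _ m1) ?lee_fin//.
rewrite (ge0_integralZl _ _ m2) ?lee_fin//; first by rewrite density_indic.
by move=> y _; rewrite mule_ge0// lee_fin.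
Qed.

(** Indicators, simple functions, then monotone convergence. It turns integrals against a normal law
    into Lebesgue integrals weighted by the density. *)
Lemma ge0_integral_density f : measurable_fun setT f -> (forall x, 0 <= f x) ->
  \int[nu]_x f x = \int[m]_x (f x * (g x)%:E).
Proof.
move=> mf f0; pose f_ := nnsfun_approx measurableT mf.
have -> : \int[nu]_x f x = limn (fun n => \int[nu]_x (f_ n x)%:E).
  rewrite -monotone_convergence//=.
  - apply: eq_integral => x /[!inE] xD; apply/esym/cvg_lim => //=.
    exact: cvg_nnsfun_approx.
  - by move=> n; exact: measurableT_comp.
  - by move=> n x _; rewrite lee_fin.
  - by move=> x _ a b ab; rewrite lee_fin//; exact/lefP/nd_nnsfun_approx.
transitivity (limn (fun n => \int[m]_x ((f_ n x)%:E * (g x)%:E))).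
  by congr (limn _); apply/funext => n; exact: density_nnsfun.
rewrite -monotone_convergence//=.
- apply: eq_integral => x /[!inE] xD; apply/cvg_lim => //=.
  apply: cvgeZr => //; exact: cvg_nnsfun_approx.
- move=> n; apply: emeasurable_funM; last exact/measurable_EFinP.
  exact/measurable_EFinP.
- by move=> n x _; rewrite mule_ge0 ?lee_fin.
- move=> x _ a b ab; rewrite lee_wpmul2r ?lee_fin//.
  exact/lefP/nd_nnsfun_approx.
Qed.

End density.

Section shear.
Context {R : realType}.
Local Notation TR := (measurableTypeR R).
Local Notation leb := (@lebesgue_measure R).
Local Open Scope ereal_scope.

Lemma lebesgue_measure_shift (a : R) (A : set R) : measurable A ->
  pushforward leb ((fun x => x + a)%R : _ -> TR) A = leb A.
Proof.
have ms : measurable_fun setT ((fun x => x + a)%R : TR -> TR).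
  exact: measurable_funD.
pose ms_mixin := isMeasurableFun.Build _ _ _ _ _ ms.
pose ms_pack : {mfun TR >-> TR} := HB.pack ((fun x => x + a)%R : TR -> TR) ms_mixin.
move=> mA; apply/esym.
apply: (@lebesgue_measure_unique R (pushforward leb ms_pack)) => // _ [[b c]] _ <- /=.
rewrite /pushforward.
rewrite (_ : _ @^-1` _ = `](b - a)%R, (c - a)%R]%classic); last first.
  by apply/seteqP; split => x /=; rewrite !in_itv /= => /andP[? ?]; apply/andP; split; lra.
rewrite !lebesgue_measure_itv /= !lte_fin; congr (if _ then _ else _).
  by apply/idP/idP => ?; lra.
by rewrite -!EFinB; congr EFin; ring.
Qed.

Lemma integral_shift (a : R) (f : TR -> \bar R) : measurable_fun setT f ->
  (forall x, 0 <= f x) -> \int[leb]_x f (x + a)%R = \int[leb]_x f x.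
Proof.
move=> mf f0.
have ms : measurable_fun setT ((fun x => x + a)%R : TR -> TR).
  exact: measurable_funD.
rewrite -[LHS](ge0_integral_pushforward ms leb measurableT mf)//.
by apply: eq_measure_integral => A mA _; exact: lebesgue_measure_shift.
Qed.

(** Kept iterated, since a shear translates one variable with the other fixed; Tonelli exchanges the
    roles of the two variables. *)
Definition iterated_integral (f : TR * TR -> \bar R) := \int[leb]_x \int[leb]_y f (x, y).
Local Notation I := iterated_integral.

Lemma integral_shear2 (t : R) (f : TR * TR -> \bar R) : measurable_fun setT f ->
  (forall x, 0 <= f x) -> I f = I (fun p => f (p.1, p.2 + t * p.1)%R).
Proof.
move=> mf f0; apply: eq_integral => x _ /=.
apply/esym/(@integral_shift (t * x)%R (fun y => f (x, y))) => //.
by apply: measurableT_comp mf _; exact: measurable_pair1.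
Qed.

Lemma integral_shear1 (t : R) (f : TR * TR -> \bar R) : measurable_fun setT f ->
  (forall x, 0 <= f x) -> I f = I (fun p => f (p.1 + t * p.2, p.2)%R).
Proof.
move=> mf f0; rewrite /I.
transitivity (\int[leb]_y \int[leb]_x f (x, y)).
  exact: (fubini_tonelli (m1 := leb) (m2 := leb) f).
transitivity (\int[leb]_y \int[leb]_x f (x + t * y, y)%R).
  apply: eq_integral => y _ /=.
  apply/esym/(@integral_shift (t * y)%R (fun x => f (x, y))) => //.
  by apply: measurableT_comp mf _; exact: measurable_pair2.
apply/esym/(fubini_tonelli (m1 := leb) (m2 := leb)
  (fun p : TR * TR => f (p.1 + t * p.2, p.2)%R)) => //.
apply: measurableT_comp mf _; apply/measurable_fun_pairP; split => /=.
  by apply: measurable_funD => //; exact: measurable_funM.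
exact: measurable_snd.
Qed.

(* For c <> -1 the rotation is the product of three shears with slopes
   s / (1 + c), - s, s / (1 + c). *)
Lemma integral_rotation (c s : R) (f : TR * TR -> \bar R) :
  (c ^+ 2 + s ^+ 2 = 1)%R -> (c != -1)%R -> measurable_fun setT f ->
  (forall x, 0 <= f x) ->
  I f = I (fun p => f (c * p.1 + s * p.2, - s * p.1 + c * p.2)%R).
Proof.
move=> cs c1 mf f0; pose t := (s / (1 + c))%R.
have c1' : (1 + c != 0)%R by rewrite addrC addr_eq0.
have m1 u : measurable_fun setT (fun p : TR * TR => (p.1 + u * p.2, p.2)%R : TR * TR).
  apply/measurable_fun_pairP; split => /=; last exact: measurable_snd.
  by apply: measurable_funD => //; exact: measurable_funM.
have m2 u : measurable_fun setT (fun p : TR * TR => (p.1, p.2 + u * p.1)%R : TR * TR).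
  apply/measurable_fun_pairP; split => /=; first exact: measurable_fst.
  by apply: measurable_funD => //; exact: measurable_funM.
have mf1 := measurableT_comp mf (m1 t).
have mf2 := measurableT_comp mf1 (m2 (- s)%R).
apply: (etrans (integral_shear1 t mf f0)).
apply: (etrans (integral_shear2 (- s) mf1 (fun x => f0 _))).
apply: (etrans (integral_shear1 t mf2 (fun x => f0 _))).
congr I; apply/funext => -[x y] /=.
have tc : (s ^+ 2 = (1 - c) * (1 + c))%R by rewrite -subr_sqr expr1n -cs; ring.
have st : (s * t = 1 - c)%R by rewrite /t mulrA -expr2 tc mulfK.
have ct : (t * (1 + c) = s)%R by rewrite /t divfK.
congr (f (_, _)).
  transitivity ((1 - s * t) * x + (t * (1 + (1 - s * t))) * y)%R; first by ring.
  by rewrite st (_ : 1 - (1 - c) = c)%R ?ct//; ring.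
transitivity (- s * x + (1 - s * t) * y)%R; first by ring.
by rewrite st; congr (_ + _ * _)%R; ring.
Qed.

Lemma normal_pdf_rotation (c s sigma x y : R) :
  (c ^+ 2 + s ^+ 2 = 1)%R -> (sigma != 0)%R ->
  (normal_pdf 0 sigma (c * x + s * y) * normal_pdf 0 sigma (- s * x + c * y) =
   normal_pdf 0 sigma x * normal_pdf 0 sigma y)%R.
Proof.
move=> cs s0; rewrite /normal_pdf (negbTE s0) /normal_fun !subr0.
rewrite mulrACA [RHS]mulrACA -expRD -[in RHS]expRD.
congr (_ * expR _)%R; rewrite -[LHS]mulrDl -[RHS]mulrDl; congr (_ / _)%R.
transitivity (- ((c ^+ 2 + s ^+ 2) * (x ^+ 2 + y ^+ 2)))%R; first by ring.
by rewrite cs; ring.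
Qed.

(** Both sides become plane integrals of an indicator times the joint density, and that density
    depends only on the squared length. *)
Lemma normal_prob_rotation (c s sigma : R) (U : set (TR * TR)) :
  (c ^+ 2 + s ^+ 2 = 1)%R -> (c != -1)%R -> sigma != 0%R -> measurable U ->
  (normal_prob 0 sigma \x normal_prob 0 sigma)
    ((fun p : TR * TR => (c * p.1 + s * p.2, - s * p.1 + c * p.2)%R : TR * TR) @^-1` U) =
  (normal_prob 0 sigma \x normal_prob 0 sigma) U.
Proof.
move=> cs c1 s0 mU; set rot := (fun p : TR * TR => _).
have mrot : measurable_fun setT rot.
  by apply/measurable_fun_pairP; split => /=; apply: measurable_funD;
    exact: measurable_funM.
pose phi := normal_pdf (0 : R) sigma.
have mphi : measurable_fun setT phi := measurable_normal_pdf _ _.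
have phi0 x : (0 <= phi x)%R by exact: normal_pdf_ge0.
pose F V (p : TR * TR) := ((\1_V p * phi p.1 * phi p.2)%:E : \bar R).
have F0 V p : 0 <= F V p by rewrite lee_fin !mulr_ge0.
have mF V : measurable V -> measurable_fun setT (F V).
  move=> mV; apply/measurable_EFinP; apply: measurable_funM; last first.
    exact: measurableT_comp.
  by apply: measurable_funM => //; exact: measurableT_comp.
have E V : measurable V -> (normal_prob 0 sigma \x normal_prob 0 sigma) V = I (F V).
  move=> mV; rewrite /product_measure1.
  rewrite (@ge0_integral_density _ _ _ leb _ phi)//; last exact: measurable_fun_xsection.
  apply: eq_integral => x _ /=; rewrite /normal_prob integral_mkcond.
  rewrite -ge0_integralZr ?lee_fin//; last 2 first.
  - apply/measurable_restrict => //; first exact: measurable_xsection.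
    by apply/measurable_EFinP; exact: measurable_funTS.
  - by move=> y _; apply: erestrict_ge0 => z _; rewrite lee_fin.
  apply: eq_integral => y _; rewrite epatch_indic -!EFinM /F; congr EFin => /=.
  rewrite !indicE mem_xsection -/phi.
  by rewrite -mulrA mulrC.
have mrU : measurable (rot @^-1` U) by rewrite -[X in measurable X]setTI; exact: mrot.
apply: (etrans (E _ mrU)); apply/esym; apply: (etrans (E _ mU)).
apply: (etrans (integral_rotation cs c1 (mF U mU) (F0 U))).
congr I; apply/funext => -[x y] /=; rewrite /F /=.
congr EFin; rewrite -!mulrA; congr (_ * _)%R.
exact/(normal_pdf_rotation x y cs s0).
Qed.

End shear.

(** * Orthonormal images of i.i.d. Gaussian vectors *)

(** The law of [f] under [mu] is [nu]. Measurability is part of the notion so that such maps compose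
    without side conditions. *)
Definition preserves (R : realType) d1 d2 (T1 : measurableType d1)
    (T2 : measurableType d2) (mu : probability T1 R) (nu : probability T2 R)
    (f : T1 -> T2) :=
  measurable_fun setT f /\ forall U, measurable U -> mu (f @^-1` U) = nu U.

Lemma measurable_pairf d1 d2 d3 (T1 : measurableType d1)
    (T2 : measurableType d2) (T3 : measurableType d3) (f : T1 -> T2) (g : T1 -> T3) :
  measurable_fun setT f -> measurable_fun setT g ->
  measurable_fun setT (fun x => (f x, g x)).
Proof. by move=> mf mg; apply/measurable_fun_pairP; split; [exact: mf|exact: mg]. Qed.

Section preserves.
Context (R : realType).
Local Open Scope ereal_scope.

Lemma preserves_id d1 (T1 : measurableType d1)
    (mu : probability T1 R) : preserves mu mu idfun.
Proof. by split; first exact: measurable_id. Qed.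

Lemma preserves_comp d1 (T1 : measurableType d1) d2 (T2 : measurableType d2)
    d3 (T3 : measurableType d3)
    (mu : probability T1 R) (nu : probability T2 R)
    (xi : probability T3 R) f g :
  preserves mu nu f -> preserves nu xi g -> preserves mu xi (g \o f).
Proof.
move=> [mf muf] [mg nug]; split; first exact: measurableT_comp.
move=> U mU; rewrite comp_preimage muf ?nug//.
by rewrite -[X in measurable X]setTI; exact: mg.
Qed.

Lemma preserves_can d1 (T1 : measurableType d1) d2 (T2 : measurableType d2)
    (mu : probability T1 R) (nu : probability T2 R) f g :
  preserves mu nu f -> measurable_fun setT g -> cancel f g ->
  preserves nu mu g.
Proof.
move=> [mf muf] mg fK; split => // U mU.
rewrite -muf; last by rewrite -[X in measurable X]setTI; exact: mg.
by rewrite -comp_preimage (_ : g \o f = id)//; exact/funext.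
Qed.

Lemma preserves_fst d1 (T1 : measurableType d1) d2 (T2 : measurableType d2)
    (mu : probability T1 R) (nu : probability T2 R) :
  preserves (mu \x nu) mu fst.
Proof.
split; first exact: measurable_fst.
move=> U mU; rewrite (_ : _ @^-1` _ = U `*` setT).
  apply: (etrans (product_measure1E mu nu mU measurableT)).
  by rewrite -[RHS]mule1; congr (_ * _); exact: probability_setT.
by apply/seteqP; split => [[x y]|[x y] []].
Qed.

Lemma preserves_prod d1 (T1 : measurableType d1) d2 (T2 : measurableType d2)
    d3 (T3 : measurableType d3) d4 (T4 : measurableType d4)
    (mu1 : probability T1 R) (mu2 : probability T2 R)
    (nu1 : probability T3 R) (nu2 : probability T4 R) f g :
  preserves mu1 nu1 f -> preserves mu2 nu2 g ->
  preserves (mu1 \x mu2) (nu1 \x nu2) (fun p => (f p.1, g p.2)).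
Proof.
move=> [mf muf] [mg mug].
have mF : measurable_fun setT (fun p : T1 * T2 => (f p.1, g p.2)).
  apply: measurable_pairf.
    by apply: (measurableT_comp mf); exact: measurable_fst.
  by apply: (measurableT_comp mg); exact: measurable_snd.
pose F_mixin := isMeasurableFun.Build _ _ _ _ _ mF.
pose F : {mfun (T1 * T2)%type >-> (T3 * T4)%type} :=
  HB.pack (fun p : T1 * T2 => (f p.1, g p.2)) F_mixin.
split=> // U mU; apply/esym.
apply: (product_measure_unique (m' := pushforward (mu1 \x mu2) F)) => // A B mA mB.
transitivity (mu1 (f @^-1` A) * mu2 (g @^-1` B)); last first.
  by congr (_ * _); [exact: muf|exact: mug].
apply: (etrans _ (product_measure1E mu1 mu2 _ _)) => //.
- by rewrite -[X in measurable X]setTI; exact: mf.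
- by rewrite -[X in measurable X]setTI; exact: mg.
Qed.

Lemma preserves_assoc d1 (T1 : measurableType d1) d2 (T2 : measurableType d2)
    d3 (T3 : measurableType d3)
    (mu : probability T1 R) (nu : probability T2 R)
    (xi : probability T3 R) :
  preserves (mu \x (nu \x xi)%E) ((mu \x nu)%E \x xi)
    (fun p => ((p.1, p.2.1), p.2.2)).
Proof.
have mF : measurable_fun setT (fun p : T1 * (T2 * T3) => ((p.1, p.2.1), p.2.2)).
  have m2 : measurable_fun setT (fun p : T1 * (T2 * T3) => p.2) by exact: measurable_snd.
  apply: measurable_pairf; last exact: measurableT_comp measurable_snd m2.
  apply: measurable_pairf; first exact: measurable_fst.
  exact: measurableT_comp measurable_fst m2.
pose F_mixin := isMeasurableFun.Build _ _ _ _ _ mF.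
pose F : {mfun (T1 * (T2 * T3))%type >-> ((T1 * T2) * T3)%type} :=
  HB.pack (fun p : T1 * (T2 * T3) => ((p.1, p.2.1), p.2.2)) F_mixin.
split=> // U mU; apply/esym.
pose PQ : probability (T1 * T2)%type R := (mu \x nu)%E.
pose PR : probability (T1 * (T2 * T3))%type R := (mu \x (nu \x xi)%E)%E.
pose M : probability ((T1 * T2) * T3)%type R := distribution PR F.
apply: (@product_measure_unique _ _ (T1 * T2)%type T3 R PQ xi M) => // A B mA mB.
rewrite /= /pushforward {1}/product_measure1 [X in _ = X * _]/product_measure1.
rewrite -ge0_integralZr//; last by exact: measurable_fun_xsection.
apply: eq_integral => x _ /=.
rewrite -[RHS]product_measure1E//; last exact: measurable_xsection.
congr (_ _); apply/seteqP; split => -[y z]; rewrite /xsection/= !inE /=.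
  by move=> [].
by [].
Qed.

End preserves.

(** * Splitting and concatenating i.i.d. tuples *)

Section iid_preserves.
Context (R : realType) d (T : measurableType d) (P : probability T R).
Local Open Scope ereal_scope.

Definition uncons n (t : n.+1.-tuple T) := (thead t, behead_tuple t).

Lemma measurable_uncons n : measurable_fun setT (@uncons n).
Proof.
apply/measurable_fun_pairP; split => /=; first exact: measurable_tnth.
apply/measurable_fun_tnthP => i.
rewrite (_ : _ \o _ = fun t : n.+1.-tuple T => tnth t (lift ord0 i)).
  exact: measurable_tnth.
by apply/funext => t; case/tupleP: t => x t /=; rewrite tnthS; congr tnth; exact: val_inj.
Qed.

Lemma cons_pairK n : cancel (@cons_pair _ T n) (@uncons n).
Proof. by move=> [x t]; rewrite /uncons /cons_pair /= theadE; congr pair; exact: val_inj. Qed.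

Lemma uncons_cons n x (t : n.-tuple T) : uncons [tuple of x :: t] = (x, t).
Proof. exact: (cons_pairK (x, t)). Qed.

Lemma preserves_cons n : preserves (P \x iid P n) (iid P n.+1) (@cons_pair _ T n).
Proof. by split; first exact: measurable_cons_pair. Qed.

Lemma preserves_uncons n : preserves (iid P n.+1) (P \x iid P n) (@uncons n).
Proof.
apply: preserves_can (preserves_cons n) (@measurable_uncons n) _.
exact: cons_pairK.
Qed.

Definition cat_pair m n (p : m.-tuple T * n.-tuple T) := cat_tuple p.1 p.2.

Lemma preserves_cat m n : preserves (iid P m \x iid P n) (iid P (m + n)) (@cat_pair m n).
Proof.
elim: m => [|m IH].
  have E (p : 0.-tuple T * n.-tuple T) : cat_pair p = p.2 :> (0 + n).-tuple T.
    by case: p => s t; apply: val_inj => /=; rewrite (tuple0 s).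
  split; first by rewrite (funext E); exact: measurable_snd.
  move=> U mU; transitivity (\int[\d_([tuple] : 0.-tuple T)]_x
      iid P n (xsection (@cat_pair 0 n @^-1` U) x)); first by [].
  rewrite integral_dirac//; last first.
    apply: measurable_fun_xsection; rewrite (funext E).
    by rewrite -[X in measurable X]setTI; exact: measurable_snd.
  rewrite diracT mul1e; congr (iid P n _); apply/seteqP.
  by split => t; rewrite /xsection /= inE /= E.
have mV : measurable_fun setT
    (fun p : (T * m.-tuple T) * n.-tuple T => (p.1.1, (p.1.2, p.2))).
  have m1 : measurable_fun setT (fun p : (T * m.-tuple T) * n.-tuple T => p.1).
    exact: measurable_fst.
  apply: measurable_pairf; first exact: measurableT_comp measurable_fst m1.
  apply: measurable_pairf; last exact: measurable_snd.
  exact: measurableT_comp measurable_snd m1.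
have pV := preserves_can (preserves_assoc P (iid P m) (iid P n)) mV _.
have {}pV := pV (fun p => match p with (a, (b, c)) => erefl end).
have pU := preserves_prod (preserves_uncons m) (preserves_id (iid P n)).
have pI := preserves_prod (preserves_id P) IH.
have [mC pC] := preserves_comp (preserves_comp (preserves_comp pU pV) pI)
  (preserves_cons (m + n)).
have E : @cat_pair m.+1 n = cons_pair (k:=m + n) \o ((fun p => (p.1, cat_pair p.2)) \o
  ((fun p => (p.1.1, (p.1.2, p.2))) \o (fun p => (uncons p.1, p.2)))).
  by apply/funext => -[s t]; case/tupleP: s => x s; apply: val_inj.
by rewrite E; split.
Qed.

Lemma preserves_split m n : preserves (iid P (m + n)) (iid P m \x iid P n)
  (fun t => ([tuple tnth t (lshift n i) | i < m], [tuple tnth t (rshift m i) | i < n])).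
Proof.
apply: preserves_can (preserves_cat m n) _ _.
  apply: measurable_pairf; apply/measurable_fun_tnthP => i.
    under [X in measurable_fun _ X]funext => t do rewrite /= tnth_mktuple.
    exact: measurable_tnth.
  under [X in measurable_fun _ X]funext => t do rewrite /= tnth_mktuple.
  exact: measurable_tnth.
move=> [s t]; congr pair; apply: eq_from_tnth => i; rewrite tnth_mktuple.
  by rewrite tnth_lshift.
by rewrite tnth_rshift.
Qed.

End iid_preserves.

(** * Rotations of a pair of independent Gaussians *)

Section gaussian_rotation.
Context (R : realType) (v : R).
Hypothesis v0 : 0 < v.
Local Notation g := (gaussian v).
Local Open Scope ereal_scope.

Definition rotate (c s : R) (p : R * R) : R * R :=
  (c * p.1 + s * p.2, - s * p.1 + c * p.2)%R.

Lemma measurable_rotate (c s : R) : measurable_fun setT (rotate c s).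
Proof. by apply: measurable_pairf; apply: measurable_funD; exact: measurable_funM. Qed.

Let rotate_generic (c s : R) : (c ^+ 2 + s ^+ 2 = 1)%R -> (c != -1)%R ->
  preserves (g \x g) (g \x g) (rotate c s).
Proof.
move=> cs c1; split; first exact: measurable_rotate.
have pB : preserves (normal_prob (0 : R) (Num.sqrt v)) g (@borel_id R).
  by split; first exact: measurable_borel_id.
have [mB pBB] := preserves_prod pB pB.
have s0 : (Num.sqrt v != 0)%R by rewrite gt_eqF// sqrtr_gt0.
move=> U mU; have mrU : measurable (rotate c s @^-1` U).
  by rewrite -[X in measurable X]setTI; exact: measurable_rotate.
apply: (etrans (esym (pBB _ mrU))); apply: (etrans _ (pBB _ mU)).
have mbU : measurable ((fun p : measurableTypeR R * measurableTypeR R => (borel_id p.1, borel_id p.2)) @^-1` U).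
  by rewrite -[X in measurable X]setTI; exact: mB.
exact: (normal_prob_rotation cs c1 s0 mbU).
Qed.

Lemma preserves_rotate (c s : R) : (c ^+ 2 + s ^+ 2 = 1)%R ->
  preserves (g \x g) (g \x g) (rotate c s).
Proof.
have [->|c1 cs] := eqVneq c (-1)%R; last exact: rotate_generic.
move=> /eqP; rewrite sqrrN expr1n -subr_eq0 addrC addKr sqrf_eq0 => /eqP ->.
(* The half turn, where the factorization into shears breaks down, is the square of a quarter
   turn. *)
have p0 : preserves (g \x g) (g \x g) (rotate 0 1).
  by apply: rotate_generic; rewrite ?expr0n/= ?expr1n ?add0r// eq_sym oppr_eq0 oner_eq0.
rewrite (_ : rotate _ _ = rotate 0 1 \o rotate 0 1); first exact: (preserves_comp p0 p0).
by apply/funext => -[x y]; rewrite /rotate /=; congr pair; ring.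
Qed.

(** Negation is the half turn of the plane seen on the first coordinate. *)
Lemma preserves_opp : preserves g g (fun x => - x)%R.
Proof.
have mo : measurable_fun setT (fun x : R => - x)%R by exact: measurable_funN.
split => // U mU.
have [mf pf] := preserves_fst g g.
have [mr pr] : preserves (g \x g) (g \x g) (rotate (-1) 0).
  by apply: preserves_rotate; rewrite sqrrN expr1n expr0n addr0.
have mNU : measurable ((fun x : R => - x)%R @^-1` U).
  by rewrite -[X in measurable X]setTI; exact: mo.
apply: (etrans (esym (pf _ mNU))); apply/esym; apply: (etrans (esym (pf _ mU))).
have mfU : measurable (fst @^-1` U : set (R * R)).
  by rewrite -[X in measurable X]setTI; exact: mf.
apply: (etrans (esym (pr _ mfU))); congr (_ _); apply/seteqP.
by split => -[x y] /=; rewrite mul0r addr0 mulN1r.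
Qed.

End gaussian_rotation.

(** * Rotations in higher dimension and orthonormal frames *)

Section orthonormal.
Context (R : realType) (v : R).
Hypothesis v0 : 0 < v.
Local Notation g := (gaussian v).

Definition dot n (a b : n.-tuple R) := \sum_(i < n) tnth a i * tnth b i.

Lemma dot_cons n x y (a b : n.-tuple R) :
  dot [tuple of x :: a] [tuple of y :: b] = x * y + dot a b.
Proof.
rewrite /dot big_ord_recl !tnth0; congr (_ + _).
by apply: eq_bigr => i _; rewrite !tnthS.
Qed.

Lemma dot_ge0 n (a : n.-tuple R) : 0 <= dot a a.
Proof. by apply: sumr_ge0 => i _; rewrite -expr2 sqr_ge0. Qed.

Lemma dot_cat m n (a a' : m.-tuple R) (b b' : n.-tuple R) :
  dot (cat_tuple a b) (cat_tuple a' b') = dot a a' + dot b b'.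
Proof.
rewrite /dot big_split_ord /=; congr (_ + _); apply: eq_bigr => i _.
  by rewrite !tnth_lshift.
by rewrite !tnth_rshift.
Qed.

Lemma dot_nseq0 n (a : n.-tuple R) : dot (nseq_tuple n 0) a = 0.
Proof. by rewrite /dot big1// => i _; rewrite tnth_nseq mul0r. Qed.

(** Successive plane rotations: the induction turns the tail of [w] into its length [r'] on one
    axis, then [rotate c s] on the first two coordinates merges [w0] and [r']. Surjectivity is
    recorded because orthonormal frames are pulled back along [phi]. *)
Lemma exists_rotation_to_axis n (w : n.+1.-tuple R) :
  exists phi : n.+1.-tuple R -> n.+1.-tuple R,
    [/\ preserves (iid g n.+1) (iid g n.+1) phi,
        forall a b, dot (phi a) (phi b) = dot a b,
        forall t, exists s, phi s = t &
        phi w = [tuple of Num.sqrt (dot w w) :: nseq_tuple n 0]].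
Proof.
elim: n w => [|n IH] w.
  case/tupleP: w => w0 w.
  pose sg : R := if w0 < 0 then -1 else 1.
  have sg2 : sg * sg = 1 by rewrite /sg; case: ifP => _; ring.
  have psg : preserves g g (fun x => sg * x).
    rewrite /sg; case: ifP => _.
      by under eq_fun do rewrite mulN1r; exact: preserves_opp.
    by under eq_fun do rewrite mul1r; exact: preserves_id.
  exists (cons_pair (k:=0) \o ((fun p => (sg * p.1, idfun p.2)) \o @uncons _ R 0)).
  split.
  - apply: preserves_comp (preserves_comp (preserves_uncons g 0) _) (preserves_cons g 0).
    exact: preserves_prod psg (preserves_id _).
  - move=> a b; case/tupleP: a => a0 a; case/tupleP: b => b0 b.
    rewrite /comp !uncons_cons !dot_cons; congr (_ + _).
    by rewrite mulrACA sg2 mul1r.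
  - move=> t; case/tupleP: t => t0 t; exists [tuple of sg * t0 :: t].
    by rewrite /comp uncons_cons; apply: val_inj; rewrite /= mulrA sg2 mul1r.
  - rewrite /comp uncons_cons dot_cons; apply: val_inj => /=.
    rewrite (tuple0 w) /dot big_ord0 addr0 -expr2 sqrtr_sqr /sg; congr cons.
    by case: ltrP => w00; [rewrite ltr0_norm// mulN1r|rewrite ger0_norm// mul1r].
case/tupleP: w => w0 w.
have [phi [pphi dphi sphi phiw]] := IH w.
set r' := Num.sqrt (dot w w) in phiw; pose r := Num.sqrt (w0 ^+ 2 + r' ^+ 2).
have r'2 : r' ^+ 2 = dot w w by rewrite sqr_sqrtr ?dot_ge0.
have rE : Num.sqrt (dot [tuple of w0 :: w] [tuple of w0 :: w]) = r.
  by rewrite dot_cons -r'2 expr2.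
have r2 : r ^+ 2 = w0 ^+ 2 + r' ^+ 2 by rewrite sqr_sqrtr// addr_ge0// sqr_ge0.
(* If [r = 0] then [w0] and [r'] both vanish and the identity rotation serves. *)
have [c [s [cs cr sr]]] : exists c s : R,
    [/\ c ^+ 2 + s ^+ 2 = 1, c * w0 + s * r' = r & - s * w0 + c * r' = 0].
  have [r0|r0] := eqVneq r 0.
    exists 1, 0; move: r2; rewrite r0 expr0n => /esym/eqP.
    rewrite paddr_eq0 ?sqr_ge0// !sqrf_eq0 => /andP[/eqP-> /eqP->].
    by split; [rewrite /= addr0 expr1n | ring | ring].
  exists (w0 / r), (r' / r); split.
  - by rewrite !exprMn -mulrDl -r2 -exprMn mulfV// expr1n.
  - by rewrite mulrAC -expr2 [X in _ + X]mulrAC -expr2 -mulrDl -r2 expr2 mulfK.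
  - by rewrite mulNr mulrAC [in X in _ + X]mulrAC [r' * w0]mulrC addNr.
pose F1 (p : R * n.+1.-tuple R) := (idfun p.1, phi p.2).
pose F2 (p : R * n.+1.-tuple R) := (idfun p.1, @uncons _ R n p.2).
pose F3 (p : R * (R * n.-tuple R)) := ((p.1, p.2.1), p.2.2).
pose F4 (p : (R * R) * n.-tuple R) := (rotate c s p.1, idfun p.2).
pose F5 (p : (R * R) * n.-tuple R) := (p.1.1, (p.1.2, p.2)).
pose F6 (p : R * (R * n.-tuple R)) := (idfun p.1, cons_pair p.2).
have p1 : preserves (g \x iid g n.+1)%E (g \x iid g n.+1)%E F1.
  exact: preserves_prod (preserves_id _) pphi.
have p2 : preserves (g \x iid g n.+1)%E (g \x (g \x iid g n))%E F2.
  exact: preserves_prod (preserves_id _) (preserves_uncons g n).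
have p3 : preserves (g \x (g \x iid g n))%E ((g \x g) \x iid g n)%E F3.
  exact: preserves_assoc.
have p4 : preserves ((g \x g) \x iid g n)%E ((g \x g) \x iid g n)%E F4.
  exact: preserves_prod (preserves_rotate v0 cs) (preserves_id _).
have p5 : preserves ((g \x g) \x iid g n)%E (g \x (g \x iid g n))%E F5.
  apply: preserves_can p3 _ _; last by move=> [x [y z]].
  have m1 : measurable_fun setT (fun p : (R * R) * n.-tuple R => p.1).
    exact: measurable_fst.
  apply: measurable_pairf; first exact: measurableT_comp measurable_fst m1.
  apply: measurable_pairf; last exact: measurable_snd.
  exact: measurableT_comp measurable_snd m1.
have p6 : preserves (g \x (g \x iid g n))%E (g \x iid g n.+1)%E F6.
  exact: preserves_prod (preserves_id _) (preserves_cons g n).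
exists (cons_pair (k:=n.+1) \o (F6 \o (F5 \o (F4 \o (F3 \o (F2 \o (F1 \o
  @uncons _ R n.+1))))))).
have phiE a0 a1 (a' : n.-tuple R) b : phi a1 = [tuple of b :: a'] ->
    (cons_pair (k:=n.+1) \o (F6 \o (F5 \o (F4 \o (F3 \o (F2 \o (F1 \o
  @uncons _ R n.+1))))))) [tuple of a0 :: a1] =
    [tuple of c * a0 + s * b :: [tuple of - s * a0 + c * b :: a']].
  move=> h; rewrite /comp uncons_cons.
  have -> : F1 (a0, a1) = (a0, [tuple of b :: a']) by rewrite /F1 /= h.
  by have -> : F2 (a0, [tuple of b :: a']) = (a0, (b, a')) by congr pair; exact: uncons_cons.
split.
- apply: preserves_comp (preserves_cons g n.+1).
  apply: preserves_comp p6; apply: preserves_comp p5; apply: preserves_comp p4.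
  apply: preserves_comp p3; apply: preserves_comp p2; apply: preserves_comp p1.
  exact: preserves_uncons.
- move=> a b; case/tupleP: a => a0 a; case/tupleP: b => b0 b.
  case/tupleP Ea: (phi a) => [x a']; case/tupleP Eb: (phi b) => [y b'].
  rewrite (phiE _ _ a' _ Ea) (phiE _ _ b' _ Eb) !dot_cons -dphi Ea Eb dot_cons.
  rewrite addrA [RHS]addrA; congr (_ + _); rewrite -[RHS]mul1r -cs; ring.
- move=> t; case/tupleP: t => x t; case/tupleP: t => y t.
  have [a1 a1E] := sphi [tuple of s * x + c * y :: t].
  exists [tuple of c * x - s * y :: a1]; rewrite (phiE _ _ t _ a1E).
  rewrite (_ : c * _ + _ = (c ^+ 2 + s ^+ 2) * x); last by ring.
  rewrite (_ : - s * _ + _ = (c ^+ 2 + s ^+ 2) * y); last by ring.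
  by rewrite cs !mul1r; apply: val_inj.
- by rewrite rE (phiE _ _ (nseq_tuple n 0) _ phiw) cr sr; apply: val_inj.
Qed.

(** Preimages of the standard basis under the rotation taking [w] to the first axis. This completes
    [w / |w|] to an orthonormal basis, and for [w = 0] it still yields some basis, so no case
    distinction arises later. *)
Lemma exists_frame n (w : n.+1.-tuple R) : exists rho : 'I_n.+1 -> n.+1.-tuple R,
  (forall i j, dot (rho i) (rho j) = (i == j)%:R) /\
  (forall i, dot w (rho i) = if i == ord0 then Num.sqrt (dot w w) else 0).
Proof.
have [phi [_ dphi sphi phiw]] := exists_rotation_to_axis w.
pose e (i : 'I_n.+1) : n.+1.-tuple R := [tuple (j == i)%:R | j < n.+1].
have de t i : dot t (e i) = tnth t i.
  rewrite /dot (bigD1 i)//= tnth_mktuple eqxx mulr1 big1 ?addr0// => j ji.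
  by rewrite tnth_mktuple (negbTE ji) mulr0.
pose rho i := projT1 (cid (sphi (e i))).
have rhoE i : phi (rho i) = e i by rewrite /rho; case: cid.
exists rho; split => [i j|i].
  by rewrite -dphi !rhoE de tnth_mktuple eq_sym.
rewrite -dphi rhoE.
rewrite phiw de; case: (unliftP ord0 i) => [j ->|->]; last by rewrite tnth0.
by rewrite tnthS tnth_nseq.
Qed.

(** After rotating [a ord0] to the first axis, it reads off the first coordinate, while the other
    functionals, being orthogonal to it, see only the remaining coordinates; induction applies to
    these. *)
Lemma preserves_dots m n (a : 'I_m -> n.-tuple R) :
  (forall i j, dot (a i) (a j) = (i == j)%:R) ->
  preserves (iid g n) (iid g m) (fun t => [tuple dot (a i) t | i < m]).
Proof.
elim: m n a => [|m IH] n a oa.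
  rewrite (_ : (fun _ => _) = cst ([tuple] : 0.-tuple R)); last first.
    by apply/funext => t; rewrite [RHS]tuple0; exact/tuple0.
  split; first exact: measurable_cst.
  move=> U mU; rewrite preimage_cst; case: ifPn => tU /=.
    by rewrite probability_setT diracE tU.
  by rewrite measure0 diracE (negbTE tU).
case: n a oa => [|n] a oa.
  by have := oa ord0 ord0; rewrite eqxx /dot big_ord0 => /esym/eqP; rewrite oner_eq0.
have [phi [pphi dphi _ phia]] := exists_rotation_to_axis (a ord0).
have {}phia : phi (a ord0) = [tuple of 1 :: nseq_tuple n 0].
  by rewrite phia oa eqxx sqrtr1.
pose b i := behead_tuple (phi (a (lift ord0 i))).
have bE i : phi (a (lift ord0 i)) = [tuple of 0 :: b i].
  have := oa ord0 (lift ord0 i); rewrite -dphi phia /b.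
  case/tupleP: (phi _) => x t; rewrite dot_cons dot_nseq0 addr0 mul1r => ->.
  by apply: val_inj.
have ob i j : dot (b i) (b j) = (i == j)%:R.
  by rewrite -[LHS]add0r -[X in X + _](mul0r 0) -dot_cons -!bE dphi oa.
have {}IH := IH n b ob.
have p : preserves (iid g n.+1) (iid g m.+1) (cons_pair (k:=m) \o
    ((fun p => (idfun p.1, [tuple dot (b i) p.2 | i < m])) \o (@uncons _ R n \o phi))).
  apply: preserves_comp (preserves_cons g m).
  apply: preserves_comp (preserves_prod (preserves_id _) IH).
  exact: preserves_comp pphi (preserves_uncons g n).
move: p; set F := (X in preserves _ _ X) => p.
suff -> : (fun t => [tuple dot (a i) t | i < m.+1]) = F by exact: p.
rewrite /F; apply/funext => t; apply: eq_from_tnth => i; rewrite tnth_mktuple -dphi /=.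
case/tupleP: (phi t) => x u; case: (unliftP ord0 i) => [j ->|->].
  rewrite tnthS tnth_mktuple bE dot_cons mul0r add0r; congr dot; exact: val_inj.
by rewrite tnth0 theadE phia dot_cons dot_nseq0 addr0 mul1r.
Qed.

End orthonormal.

(** * Gaussian tails and suprema over the sphere *)

Section arrays.
Context (R : realType).

(** Arrays over any finite index type are tuples along its enumeration. This is the encoding of
    [tensor], on which [ent] and [entry] coincide. *)
Definition ent (I : finType) (t : #|I|.-tuple R) (i : I) := tnth t (enum_rank i).

Definition arr (I : finType) (f : I -> R) : #|I|.-tuple R :=
  [tuple f (enum_val k) | k < #|I|].

Lemma ent_arr (I : finType) (f : I -> R) i : ent (arr f) i = f i.
Proof. by rewrite /ent tnth_mktuple enum_rankK. Qed.

Definition lin (I J : finType) (a : J -> I -> R) (t : #|I|.-tuple R) (j : J) :=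
  \sum_i a j i * ent t i.

Lemma dot_ent (I : finType) (s t : #|I|.-tuple R) :
  dot s t = \sum_i ent s i * ent t i.
Proof.
rewrite /dot (reindex (@enum_rank I)); first by [].
exact/onW_bij/enum_rank_bij.
Qed.

Lemma dot_arr (I : finType) (f : I -> R) (t : #|I|.-tuple R) :
  dot (arr f) t = \sum_i f i * ent t i.
Proof. by rewrite dot_ent; apply: eq_bigr => i _; rewrite ent_arr. Qed.

Lemma measurable_ent (I : finType) (i : I) :
  measurable_fun setT (fun t : #|I|.-tuple R => ent t i).
Proof. exact: measurable_tnth. Qed.

Lemma measurable_lin (I J : finType) (a : J -> I -> R) j :
  measurable_fun setT (fun t => lin a t j).
Proof.
by apply: measurable_sum => i; apply: measurable_funM => //; exact: measurable_ent.
Qed.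

Context (v : R).
Hypothesis v0 : 0 < v.
Local Notation g := (gaussian v).

(** The hypothesis says that the rows of the block matrix [[a | b]] are orthonormal, so
    [preserves_dots] applies to the concatenated array. *)
Lemma preserves_lin_dom (I1 I2 J : finType) (a : J -> I1 -> R) (b : J -> I2 -> R) :
  (forall j j', \sum_i a j i * a j' i + \sum_i b j i * b j' i = (j == j')%:R) ->
  preserves (iid g #|I1| \x iid g #|I2|)%E (iid g #|J|)
    (fun p => arr (fun j => lin a p.1 j + lin b p.2 j)).
Proof.
move=> oab; pose c (k : 'I_#|J|) := cat_tuple (arr (a (enum_val k))) (arr (b (enum_val k))).
have oc k l : dot (c k) (c l) = (k == l)%:R.
  rewrite dot_cat !dot_arr -(inj_eq (@enum_val_inj J _)) -oab.
  by congr (_ + _); apply: eq_bigr => i _; rewrite ent_arr.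
have := preserves_comp (preserves_cat g #|I1| #|I2|) (preserves_dots v0 oc).
set F := (X in preserves _ _ X); set G := (X in _ -> preserves _ _ X).
suff -> : F = G by [].
apply/funext => -[s t]; apply: eq_from_tnth => k.
by rewrite !tnth_mktuple dot_cat !dot_arr.
Qed.

(** The vanishing cross products make all rows of [a] and [b] one orthonormal family; this is what
    gives independence of the two image arrays. *)
Lemma preserves_lin_cod (I J1 J2 : finType) (a : J1 -> I -> R) (b : J2 -> I -> R) :
  (forall j j', \sum_i a j i * a j' i = (j == j')%:R) ->
  (forall j j', \sum_i b j i * b j' i = (j == j')%:R) ->
  (forall j j', \sum_i a j i * b j' i = 0) ->
  preserves (iid g #|I|) (iid g #|J1| \x iid g #|J2|)%E
    (fun t => (arr (lin a t), arr (lin b t))).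
Proof.
move=> oa ob oab.
pose c (k : 'I_(#|J1| + #|J2|)) := match fintype.split k with
  | inl k => arr (a (enum_val k)) | inr k => arr (b (enum_val k)) end.
have E (f f' : I -> R) : dot (arr f) (arr f') = \sum_i f i * f' i.
  by rewrite dot_arr; apply: eq_bigr => i _; rewrite ent_arr.
have oc k l : dot (c k) (c l) = (k == l)%:R.
  rewrite /c; case: split_ordP => i ->; case: split_ordP => j ->; rewrite E.
  - by rewrite oa (inj_eq (@enum_val_inj J1 _)) (inj_eq (@lshift_inj _ _)).
  - by rewrite oab eq_lrshift.
  - by under eq_bigr do rewrite mulrC; rewrite oab eq_rlshift.
  - by rewrite ob (inj_eq (@enum_val_inj J2 _)) (inj_eq (@rshift_inj _ _)).
have := preserves_comp (preserves_dots v0 oc) (preserves_split g #|J1| #|J2|).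
set F := (X in preserves _ _ X); set G := (X in _ -> preserves _ _ X).
suff -> : F = G by [].
apply/funext => t; rewrite /F /G /=; congr pair; apply: eq_from_tnth => k.
  rewrite !tnth_mktuple /c; case: split_ordP => j; last by move/eqP; rewrite eq_lrshift.
  by move/lshift_inj => <-; rewrite dot_arr.
rewrite !tnth_mktuple /c; case: split_ordP => j; first by move/eqP; rewrite eq_rlshift.
by move/rshift_inj => <-; rewrite dot_arr.
Qed.

End arrays.

(** * Gaussian tail bounds *)

Section tails.
Context (R : realType).

Lemma expRN_le_inv (y : R) : 0 < y -> expR (- y) <= y^-1.
Proof.
move=> y0; rewrite expRN lef_pV2 ?posrE ?expR_gt0//.
by apply: le_trans (expR_ge1Dx y); lra.
Qed.

Lemma ge_compl_le d (T : measurableType d) (P : probability T R) (A : set T) (e : R) :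
  measurable A -> (P (~` A) <= e%:E)%E -> ((1 - e)%:E <= P A)%E.
Proof.
move=> mA; rewrite probability_setC// EFinB.
rewrite -(fineK (fin_num_measure P A mA)) -!EFinB !lee_fin; lra.
Qed.

Lemma le_compl_ge d (T : measurableType d) (P : probability T R) (A : set T) (e : R) :
  measurable A -> ((1 - e)%:E <= P A)%E -> (P (~` A) <= e%:E)%E.
Proof.
move=> mA; rewrite probability_setC// EFinB.
rewrite -(fineK (fin_num_measure P A mA)) -!EFinB !lee_fin; lra.
Qed.

Lemma measurable_gt_event d (T : measurableType d) (f : T -> R) (c : R) :
  measurable_fun setT f -> measurable [set t | c < f t].
Proof.
move=> mf; rewrite -[X in measurable X]setTI.
have := mf measurableT _ (measurable_itv `]c, +oo[).
by congr (measurable (_ `&` _)); apply/seteqP; split => t /=; rewrite in_itv /= andbT.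
Qed.

Lemma measurable_le_event d (T : measurableType d) (f : T -> R) (c : R) :
  measurable_fun setT f -> measurable [set t | f t <= c].
Proof.
move=> mf; rewrite -[X in measurable X]setTI.
have := mf measurableT _ (measurable_itv `]-oo, c]).
by congr (measurable (_ `&` _)); apply/seteqP; split => t /=; rewrite in_itv /=.
Qed.

(** For [x <= - e] one has [x^2 >= e^2 + (x + e)^2], so the density at [x] is at most
    [exp(- e^2 / (2 v))] times that of the law recentred at [- e]. The latter has mass at most 1,
    and [exp(- y) <= 1 / y] gives the rational bound. *)
Lemma gaussian_tail (v e : R) : 0 < v -> 0 < e ->
  ((1 - 2 * v / e ^+ 2)%:E <= gaussian v [set x : R | (- e < x)%R])%E.
Proof.
move=> v0 e0; apply: ge_compl_le.
  exact: (measurable_gt_event _ (@measurable_id _ _ setT)).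
have s0 : Num.sqrt v != 0 :> R by rewrite gt_eqF// sqrtr_gt0.
set A := ~` _.
have mA : measurable (A : set (measurableTypeR R)).
  by apply: measurableC; exact: (measurable_gt_event _ (@measurable_id _ _ setT)).
have k0 : 0 <= 2 * v / e ^+ 2 by rewrite divr_ge0 ?sqr_ge0// mulr_ge0// ltW.
have mp m : measurable_fun A (fun x => (normal_pdf (m : R) (Num.sqrt v) x)%:E).
  by apply/measurable_EFinP/measurable_funTS; exact: measurable_normal_pdf.
apply: (@le_trans _ _ (normal_prob 0 (Num.sqrt v) A)); first by [].
apply: (@le_trans _ _ ((2 * v / e ^+ 2)%:E * normal_prob (- e) (Num.sqrt v) A)%E).
  have pdf0 (m : R) (x : measurableTypeR R) : A x ->
      (0 <= (normal_pdf m (Num.sqrt v) x)%:E)%E.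
    by move=> _; rewrite lee_fin normal_pdf_ge0.
  rewrite /normal_prob; apply: (@le_trans _ _ (\int[lebesgue_measure]_(x in A)
      ((2 * v / e ^+ 2)%:E * (normal_pdf (- e) (Num.sqrt v) x)%:E))%E); last first.
    rewrite le_eqVlt; apply/orP; left; apply/eqP.
    by apply: ge0_integralZl; [exact: mA|exact: mp|exact: pdf0|rewrite lee_fin].
  apply: ge0_le_integral; [exact: mA|exact: pdf0|exact: mp| |].
  - by apply: emeasurable_funM => //; exact: mp.
  move=> x /negP; rewrite -leNgt => xe; rewrite -EFinM lee_fin.
  rewrite /normal_pdf (negbTE s0) /normal_fun mulrCA ler_wpM2l ?normal_peak_ge0//.
  rewrite !sqr_sqrtr ?(ltW v0)// subr0 opprK -mulr_natl.
  apply: (@le_trans _ _ (expR (- (e ^+ 2 / (2 * v))) * expR (- (x + e) ^+ 2 / (2 * v)))).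
    rewrite -expRD ler_expR !mulNr -opprD lerN2 -mulrDl ler_pM2r ?invr_gt0 ?mulr_gt0//.
    have : 0 <= e * - (x + e) by rewrite mulr_ge0 ?(ltW e0)//; lra.
    by rewrite sqrrD; lra.
  rewrite ler_wpM2r ?expR_ge0//.
  by apply: le_trans (expRN_le_inv _) _; rewrite ?divr_gt0 ?exprn_gt0 ?mulr_gt0// invf_div.
rewrite -[leRHS]mule1 lee_wpmul2l ?lee_fin//.
exact: probability_le1.
Qed.

(** [a / |a|] is an orthonormal family with one member, so the form is [|a|] times a single
    Gaussian, and a factor [|a| <= 1] keeps a value above [- e]. *)
Lemma gaussian_linear_tail (I : finType) (a : I -> R) (v e : R) :
  0 < v -> 0 < e -> \sum_i a i ^+ 2 <= 1 ->
  ((1 - 2 * v / e ^+ 2)%:E <=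
    iid (gaussian v) #|I| [set t | - e < \sum_i a i * ent t i]%R)%E.
Proof.
move=> v0 e0 a1; set q2 := \sum_i _ in a1.
have k0 : 0 <= 2 * v / e ^+ 2 by rewrite divr_ge0 ?sqr_ge0// mulr_ge0// ltW.
(* [a = 0] cannot be normalized, but then the event is the whole space. *)
have [q0|q0] := eqVneq q2 0.
  rewrite (_ : [set t | _] = setT); first by rewrite probability_setT lee_fin; lra.
  apply/seteqP; split => // t _ /=; rewrite big1 ?oppr_lt0// => i _.
  have /eqP := q0; rewrite psumr_eq0 => [|j _]; last exact: sqr_ge0.
  by move=> /allP/(_ i); rewrite mem_index_enum sqrf_eq0 => /(_ isT)/eqP ->; rewrite mul0r.
have q2_ge0 : 0 <= q2 by apply: sumr_ge0 => i _; exact: sqr_ge0.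
pose q := Num.sqrt q2.
have qq : q ^+ 2 = q2 by rewrite sqr_sqrtr.
have q_gt0 : 0 < q by rewrite sqrtr_gt0 lt_neqAle eq_sym q0.
have q1 : q <= 1 by rewrite -sqrtr1 ler_wsqrtr.
pose b (k : 'I_1) := arr (fun i => a i / q).
have ob k l : dot (b k) (b l) = (k == l)%:R.
  rewrite !ord1 eqxx dot_arr -[RHS](mulfV q0) /q2 mulr_suml; apply: eq_bigr => i _.
  by rewrite ent_arr mulrACA -!expr2 exprVn qq.
have p := preserves_comp (preserves_comp (preserves_dots v0 ob)
  (preserves_uncons (gaussian v) 0)) (preserves_fst _ _).
have mr : measurable [set x : R | - e < x].
  exact: (measurable_gt_event _ (@measurable_id _ _ setT)).
apply: (le_trans (gaussian_tail v0 e0)); rewrite -(p.2 _ mr).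
apply: le_measure.
- by rewrite inE -[X in measurable X]setTI; apply: p.1.
- rewrite inE; apply: measurable_gt_event.
  exact: (measurable_lin (fun _ : 'I_1 => a) ord0).
move=> t /=; rewrite /thead tnth_mktuple dot_arr => ht.
rewrite (_ : \sum_i _ = q * \sum_i a i / q * ent t i); last first.
  rewrite mulr_sumr; apply: eq_bigr => i _.
  by rewrite mulrA mulrCA mulfV ?gt_eqF// mulr1.
by rewrite -ltrNl in ht *; nra.
Qed.

Lemma integral_gaussian (v : R) (f : R -> \bar R) : 
  measurable_fun setT f -> (forall x, 0 <= f x)%E ->
  (\int[gaussian v]_x f x =
   \int[lebesgue_measure]_x (f x * (normal_pdf 0 (Num.sqrt v) x)%:E))%E.
Proof.
move=> mf f0; rewrite /gaussian /distribution ge0_integral_pushforward//=.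
apply: (@ge0_integral_density _ (measurableTypeR R) R lebesgue_measure
  (normal_prob 0 (Num.sqrt v)) (normal_pdf 0 (Num.sqrt v))) => //.
- exact: measurable_normal_pdf.
- exact: normal_pdf_ge0.
Qed.

Lemma measurable_expR_sqr (tau : R) :
  measurable_fun setT (fun x : R => expR (tau * x ^+ 2)).
Proof.
by apply: measurableT_comp => //; apply: measurable_funM.
Qed.

(** [exp(- tau x^2)] times the density of deviation [s] is [1 / k] times the density of deviation
    [s / k], which has mass 1. *)
Lemma integral_gaussian_expR_sqr (v tau : R) : 0 < v -> 0 < tau ->
  (\int[gaussian v]_x (expR (- tau * x ^+ 2))%:E =
   ((Num.sqrt (1 + 2 * tau * v))^-1)%:E)%E.
Proof.
move=> v0 tau0; have mf : measurable_fun setT (fun x : R => expR (- tau * x ^+ 2)).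
  exact: measurable_expR_sqr.
rewrite integral_gaussian//; last first.
  exact/measurable_EFinP.
set k := Num.sqrt (1 + 2 * tau * v); set s := Num.sqrt v.
have k2 : k ^+ 2 = 1 + 2 * tau * v by rewrite sqr_sqrtr// addr_ge0// !mulr_ge0// ltW.
have k0 : 0 < k by rewrite sqrtr_gt0 ltr_pwDl// !mulr_ge0// ltW.
have s0 : 0 < s by rewrite sqrtr_gt0.
have s2 : s ^+ 2 = v by rewrite sqr_sqrtr// ltW.
have sk0 : s / k != 0 by rewrite gt_eqF// divr_gt0.
have peakE : normal_peak s = k^-1 * normal_peak (s / k).
  rewrite /normal_peak (_ : (s / k) ^+ 2 * pi *+ 2 = k^-1 ^+ 2 * (s ^+ 2 * pi *+ 2)).
    rewrite sqrtrM ?sqr_ge0// sqrtr_sqr gtr0_norm ?invr_gt0// invfM invrK mulKf//.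
    by rewrite gt_eqF.
  by rewrite exprMn [RHS]mulrnAr; congr (_ *+ 2); rewrite [RHS]mulrCA mulrA.
transitivity (\int[lebesgue_measure]_x ((k^-1)%:E * (normal_pdf 0 (s / k) x)%:E))%E.
  apply: eq_integral => x _; rewrite -!EFinM; congr EFin.
  rewrite /normal_pdf (negbTE sk0) gt_eqF// peakE mulrCA -!mulrA; congr (_ * (_ * _)).
  rewrite /normal_fun -expRD !subr0; congr expR.
  rewrite expr_div_n s2 k2; field.
  by rewrite !gt_eqF//= ?ltr_pwDl// !mulr_ge0// ltW.
rewrite ge0_integralZl//.
- by rewrite integral_normal_pdf mule1.
- by apply/measurable_EFinP; exact: measurable_normal_pdf.
- by move=> x _; rewrite lee_fin normal_pdf_ge0.
- by rewrite lee_fin invr_ge0 ltW.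
Qed.

Lemma measurable_dot n : measurable_fun setT (fun t : n.-tuple R => dot t t).
Proof. by apply: measurable_sum => i; apply: measurable_funM; exact: measurable_tnth. Qed.

(** Induction on the dimension with [c] arbitrary: the section over a first coordinate [x] is the
    same event with threshold [c - x^2], and integrating [exp(- tau x^2)] supplies one more
    factor. *)
Lemma chernoff_sqr (v tau c : R) n : 0 < v -> 0 < tau ->
  (iid (gaussian v) n [set t | dot t t <= c]%R <=
   (expR (tau * c) * ((Num.sqrt (1 + 2 * tau * v))^-1) ^+ n)%:E)%E.
Proof.
move=> v0 tau0; elim: n c => [|n IH] c.
  rewrite expr0 mulr1 /= diracE; case: (boolP (_ \in _)) => [|_]; last first.
    by rewrite lee_fin expR_ge0.
  rewrite inE /= /dot big_ord0 => c0; rewrite lee_fin.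
  by apply: le_trans (expR_ge1Dx _); rewrite lerDl mulr_ge0// ltW.
set rho := (Num.sqrt _)^-1 in IH *.
have rho0 : 0 <= rho by rewrite invr_ge0 sqrtr_ge0.
have mc : measurable_fun setT (fun x : R => expR (- tau * x ^+ 2)).
  exact: measurable_expR_sqr.
have mU : measurable [set t : n.+1.-tuple R | dot t t <= c].
  exact: (measurable_le_event _ (@measurable_dot n.+1)).
rewrite -(preserves_cons _ _).2// /product_measure1.
apply: (@le_trans _ _ (\int[gaussian v]_x
    ((expR (tau * c) * rho ^+ n)%:E * (expR (- tau * x ^+ 2))%:E))%E); last first.
  have c0 : 0 <= expR (tau * c) * rho ^+ n by rewrite mulr_ge0 ?expR_ge0 ?exprn_ge0.
  rewrite ge0_integralZl ?lee_fin//.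
    by rewrite integral_gaussian_expR_sqr// exprS lee_fin mulrA mulrAC.
  exact/measurable_EFinP.
apply: ge0_le_integral => //.
- apply: measurable_fun_xsection; rewrite -[X in measurable X]setTI.
  exact: measurable_cons_pair.
- by apply: emeasurable_funM => //; exact/measurable_EFinP.
move=> x _; rewrite -EFinM mulrAC -expRD.
rewrite (_ : tau * c + _ = tau * (c - x ^+ 2)); last by ring.
have := IH (c - x ^+ 2).
suff -> : [set t | dot t t <= c - x ^+ 2] = xsection (@cons_pair _ _ n @^-1`
  [set t | dot t t <= c]) x by [].
apply/seteqP; split => t; rewrite /xsection /= inE /= /cons_pair /= dot_cons -expr2 => ?; lra.
Qed.

(** [v] and [n] are linked only by [n v >= 2 - v0], not by [v = 2 / n], because the recursion lowers
    the dimension while the variance stays. *)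
Lemma gaussian_norm_tail (eta del : R) : 0 < eta -> eta < 1 -> 0 < del ->
  exists2 v0, 0 < v0 & forall v n, 0 < v <= v0 -> 2 - v0 <= n%:R * v ->
  ((1 - del)%:E <= iid (gaussian v) n [set t | 2 - eta < dot t t]%R)%E.
Proof.
move=> eta0 eta1 del0; exists (Num.min (eta / 4) (del * eta ^+ 2 / 32)).
  by rewrite lt_min !divr_gt0// mulr_gt0// exprn_gt0.
move=> v n /andP[v0]; rewrite le_min => /andP[v1 v2] nv.
have {}nv : 2 - eta / 4 <= n%:R * v.
  by apply: le_trans nv; rewrite lerB// ge_min lexx.
apply: ge_compl_le.
  exact: (measurable_gt_event _ (@measurable_dot n)).
rewrite (_ : ~` _ = [set t | dot t t <= 2 - eta]); last first.
  by apply/seteqP; split => t /=; rewrite leNgt => /negP.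
(* Taking [tau = y / (2 v)] makes each factor [(1 + y)^(-1/2)], at most [exp(- (y - y^2) / 2)]. With
   [n v >= 2 - eta / 4] the choice [y = eta / 8] lets the term linear in [y] outweigh the quadratic
   loss, leaving the exponent [- eta^2 / (32 v)]. *)
pose y := eta / 8; have y0 : 0 < y by rewrite divr_gt0.
have tau0 : 0 < y / (2 * v) by rewrite divr_gt0 ?mulr_gt0.
apply: (le_trans (chernoff_sqr _ _ v0 tau0)); rewrite lee_fin.
have -> : 1 + 2 * (y / (2 * v)) * v = 1 + y by field; rewrite gt_eqF.
have h : (Num.sqrt (1 + y))^-1 <= expR (- (y - y ^+ 2) / 2).
  have e0 : 0 < expR ((y - y ^+ 2) / 2) by exact: expR_gt0.
  rewrite mulNr expRN lef_pV2 ?posrE ?sqrtr_gt0 ?addr_gt0//.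
  rewrite -(@ler_pXn2r _ 2) ?nnegrE ?sqrtr_ge0 ?(ltW e0)//.
  rewrite sqr_sqrtr ?addr_ge0 ?(ltW y0)// -expRM_natl.
  rewrite (_ : 2%:R * _ = y - y ^+ 2); last by field.
  rewrite -[leLHS]invrK -expRN -[leRHS]invrK lef_pV2 ?posrE ?expR_gt0 ?invr_gt0 ?addr_gt0//.
  apply: (@le_trans _ _ (1 - (y - y ^+ 2))); last by rewrite -[leRHS]/(expR _); apply: expR_ge1Dx.
  rewrite -[leLHS]mul1r ler_pdivrMr ?addr_gt0//.
  have : 0 <= y ^+ 3 by rewrite exprn_ge0// ltW.
  by rewrite /=; lra.
have {}h : (Num.sqrt (1 + y))^-1 ^+ n <= expR (- (y - y ^+ 2) / 2 * n%:R).
  by rewrite mulrC expRM_natl lerXn2r ?nnegrE ?expR_ge0// invr_ge0 sqrtr_ge0.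
apply: (le_trans (ler_wpM2l (expR_ge0 _) h)); rewrite -expRD.
have nE : n%:R = n%:R * v / v by rewrite mulfK// gt_eqF.
apply: (@le_trans _ _ (expR (- (eta ^+ 2 / (32 * v))))).
  rewrite ler_expR (_ : y / (2 * v) * (2 - eta) + - (y - y ^+ 2) / 2 * n%:R = (y * (2 - eta) - (y - y ^+ 2) * (n%:R * v)) / (2 * v)).
    rewrite (_ : - (eta ^+ 2 / (32 * v)) = (- (eta ^+ 2 / 16)) / (2 * v)); last first.
      by field; rewrite gt_eqF.
    rewrite ler_pM2r ?invr_gt0 ?mulr_gt0//.
    have yy : 0 <= y - y ^+ 2 by rewrite subr_ge0 expr2 ler_piMl ?(ltW y0)// /y; lra.
    have : (y - y ^+ 2) * (2 - eta / 4) <= (y - y ^+ 2) * (n%:R * v).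
      exact: ler_wpM2l.
    rewrite /y; nra.
  by field; rewrite gt_eqF.
apply: (le_trans (expRN_le_inv _)); first by rewrite divr_gt0 ?exprn_gt0 ?mulr_gt0.
rewrite invf_div ler_pdivrMr ?exprn_gt0//; lra.
Qed.

End tails.

(** * Measurability of events defined by a supremum over the sphere *)

Section sphere_event.
Context (R : realType).

Lemma cvg_finsum (I : Type) (s : seq I) (f : I -> nat -> R) (l : I -> R) :
  (forall i, f i k @[k --> \oo] --> l i) ->
  (\sum_(i <- s) f i k) @[k --> \oo] --> \sum_(i <- s) l i.
Proof.
move=> fl; elim: s => [|i s IH].
  by rewrite big_nil; under eq_fun do rewrite big_nil; exact: cvg_cst.
by rewrite big_cons; under eq_fun do rewrite big_cons; exact: cvgD.
Qed.

Lemma cvg_finprod (I : Type) (s : seq I) (f : I -> nat -> R) (l : I -> R) :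
  (forall i, f i k @[k --> \oo] --> l i) ->
  (\prod_(i <- s) f i k) @[k --> \oo] --> \prod_(i <- s) l i.
Proof.
move=> fl; elim: s => [|i s IH].
  by rewrite big_nil; under eq_fun do rewrite big_nil; exact: cvg_cst.
by rewrite big_cons; under eq_fun do rewrite big_cons; exact: cvgM.
Qed.

Definition unit_vec (I : finType) (u : I -> R) := \sum_i u i ^+ 2 = 1.

(* Integer vectors point in a dense set of directions. *)
Lemma measurable_sphere_event d (T : measurableType d) (I : finType)
    (phi : T -> (I -> R) -> R) (c : R) :
  (forall u, measurable_fun setT (phi ^~ u)) ->
  (forall t (w : nat -> I -> R) u, (forall i, w k i @[k --> \oo] --> u i) ->
    phi t (w k) @[k --> \oo] --> phi t u) ->
  measurable [set t | exists2 u, unit_vec u & c < phi t u].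
Proof.
move=> mphi cphi.
pose nrm (z : {ffun I -> int}) := \sum_i ((z i)%:~R : R) ^+ 2.
pose dir (z : {ffun I -> int}) i : R := (z i)%:~R / Num.sqrt (nrm z).
have dirP z : nrm z != 0 -> unit_vec (dir z).
  move=> z0; rewrite /unit_vec; under eq_bigr do rewrite expr_div_n.
  rewrite -mulr_suml sqr_sqrtr ?mulfV//.
  by apply: sumr_ge0 => i _; exact: sqr_ge0.
rewrite (_ : [set t | _] = \bigcup_(z : {ffun I -> int})
    (if nrm z == 0 then set0 else [set t | c < phi t (dir z)])).
  apply: countable_bigcupT_measurable; first exact: countableP.
  move=> z; case: ifP => _; first exact: measurable0.
  exact: measurable_gt_event.
apply/seteqP; split => t /=; last first.
  move=> [z _]; case: ifPn => // z0 ct; exists (dir z) => //; exact: dirP.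
move=> [u u1 cu].
pose z k : {ffun I -> int} := [ffun i => Num.floor (k.+1%:R * u i)].
have zk i : (z k i)%:~R / k.+1%:R @[k --> \oo] --> u i.
  have h : u i - k.+1%:R^-1 @[k --> \oo] --> u i.
    rewrite -[X in _ --> X]subr0; apply: cvgB; first exact: cvg_cst.
    exact: cvg_harmonic.
  apply: (squeeze_cvgr _ h (cvg_cst (u i))).
  near=> k; rewrite ffunE.
  have k0 : 0 < k.+1%:R :> R by [].
  rewrite ler_pdivrMr// ler_pdivlMr// mulrBl mulVf ?gt_eqF// [u i * _]mulrC.
  by rewrite ge_floor andbT lerBlDr ltW// -intrD1 lt_succ_floor.
have nk : nrm (z k) / k.+1%:R ^+ 2 @[k --> \oo] --> (1 : R).
  rewrite -[X in _ --> X]u1.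
  under eq_fun do (rewrite mulr_suml; under eq_bigr do rewrite -expr_div_n).
  by apply: cvg_finsum => i; rewrite expr2; under eq_fun do rewrite expr2; apply: cvgM; exact: zk.
have dk i : dir (z k) i @[k --> \oo] --> u i.
  have sk : Num.sqrt (nrm (z k) / k.+1%:R ^+ 2) @[k --> \oo] --> (1 : R).
    rewrite -[X in _ --> X]sqrtr1.
    by apply: continuous_cvg; [exact: sqrt_continuous|exact: nk].
  have : (z k i)%:~R / k.+1%:R * (Num.sqrt (nrm (z k) / k.+1%:R ^+ 2))^-1
      @[k --> \oo] --> u i / 1.
    by apply: cvgM; [exact: zk|apply: cvgV; rewrite ?oner_neq0].
  rewrite divr1; apply: cvg_trans; apply: near_eq_cvg; near=> k.
  have k0 : 0 < k.+1%:R :> R by [].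
  rewrite /= sqrtrM ?sumr_ge0// => [|j _]; last exact: sqr_ge0.
  rewrite -exprVn sqrtr_sqr gtr0_norm ?invr_gt0//.
  by rewrite invfM invrK mulrA mulrAC divfK// gt_eqF.
have := cphi t _ _ dk => /cvgr_gt /(_ _ cu) ck.
have := nk => /cvgr_gt /(_ _ (@ltr01 R)) n0.
near \oo => k.
exists (z k) => //; rewrite ifF; first by near: k.
apply/negbTE; have : 0 < nrm (z k) / k.+1%:R ^+ 2 by near: k.
by move=> h; apply/eqP => e; move: h; rewrite e mul0r ltxx.
Unshelve. all: by end_near.
Qed.

End sphere_event.

(** * Maximum of a Gaussian linear-plus-quadratic form *)

Section probability_bounds.
Context (R : realType).

Lemma probability_setI_ge d (T : measurableType d) (P : probability T R)
    (A B : set T) (a b : R) : measurable A -> measurable B ->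
  ((1 - a)%:E <= P A)%E -> ((1 - b)%:E <= P B)%E ->
  ((1 - (a + b))%:E <= P (A `&` B))%E.
Proof.
move=> mA mB PA PB; apply: ge_compl_le; first exact: measurableI.
rewrite setCI; apply: (le_trans (measureU2 P (measurableC mA) (measurableC mB))).
by rewrite EFinD; apply: leeD; exact: le_compl_ge.
Qed.

(** The Fubini form of conditioning on the first factor: sections over [A] have mass at least
    [1 - b], and [(1 - a) (1 - b) >= 1 - (a + b)]. *)
Lemma product_probability_ge d1 d2 (T1 : measurableType d1)
    (T2 : measurableType d2) (P1 : probability T1 R) (P2 : probability T2 R)
    (A : set T1) (E : set (T1 * T2)) (a b : R) :
  measurable A -> measurable E -> 0 <= a -> 0 <= b <= 1 ->
  ((1 - a)%:E <= P1 A)%E ->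
  (forall x, A x -> ((1 - b)%:E <= P2 (xsection E x))%E) ->
  ((1 - (a + b))%:E <= (P1 \x P2)%E E)%E.
Proof.
move=> mA mE a0 /andP[b0 b1] PA PE.
have b1' : 0 <= 1 - b by rewrite subr_ge0.
apply: (@le_trans _ _ (\int[P1]_x ((1 - b)%:E * (\1_A x)%:E))%E).
  rewrite (_ : (\int[P1]_x _ = (1 - b)%:E * P1 A)%E); last first.
    rewrite (_ : (P1 A = \int[P1]_x (\1_A x)%:E)%E); last by rewrite integral_indic// setIT.
    apply: ge0_integralZl; [exact: measurableT|exact/measurable_EFinP/measurable_indic| |].
      by move=> x _; rewrite lee_fin.
    by rewrite lee_fin.
  apply: (@le_trans _ _ ((1 - b)%:E * (1 - a)%:E)%E).
    by rewrite -EFinM lee_fin; nra.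
  by rewrite lee_wpmul2l// lee_fin.
apply: ge0_le_integral => //.
- by move=> x _; rewrite mule_ge0// lee_fin.
- by apply: emeasurable_funM => //; exact/measurable_EFinP.
- exact: measurable_fun_xsection.
move=> x _ /=; rewrite indicE; case: (boolP (x \in A)) => xA.
  by rewrite mule1; apply: PE; move: xA; rewrite inE.
by rewrite mule0.
Qed.

Lemma measurable_linear_event (I : finType) (a : I -> R) (c : R) :
  measurable [set t : #|I|.-tuple R | c < \sum_i a i * ent t i].
Proof. by apply: measurable_gt_event; exact: (measurable_lin (fun _ : 'I_1 => a) ord0). Qed.

(** [v0] is uniform in the index type and in the coefficients: the former grows with the dimension,
    the latter depend on the other random arrays. *)
Lemma gaussian_linear_tail_small (e del : R) : 0 < e -> 0 < del ->
  exists2 v0, 0 < v0 & forall v, 0 < v <= v0 ->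
  forall (I : finType) (a : I -> R), \sum_i a i ^+ 2 <= 1 ->
  ((1 - del)%:E <=
    iid (gaussian v) #|I| [set t | - e < \sum_i a i * ent t i]%R)%E.
Proof.
move=> e0 del0; exists (del * e ^+ 2 / 2); first by rewrite divr_gt0 ?mulr_gt0 ?exprn_gt0.
move=> v /andP[v0 vdel] I a a1.
apply: le_trans (gaussian_linear_tail v0 e0 a1); rewrite lee_fin lerB//.
by rewrite ler_pdivrMr ?exprn_gt0//; lra.
Qed.

End probability_bounds.

Section frame.
Context (R : realType).

Lemma sum_sum_delta (I J : finType) (rho : J -> I -> R) (U V : J -> R) :
  (forall j k, \sum_i rho j i * rho k i = (j == k)%:R) ->
  \sum_i (\sum_j U j * rho j i) * (\sum_j V j * rho j i) = \sum_j U j * V j.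
Proof.
move=> orho; under eq_bigr do rewrite big_distrlr /=.
rewrite exchange_big; apply: eq_bigr => j _; rewrite exchange_big /=.
rewrite (bigD1 j)//= [X in _ + X]big1 => [|k kj].
  under eq_bigr do rewrite mulrACA.
  by rewrite -mulr_sumr orho eqxx mulr1 addr0.
under eq_bigr do rewrite mulrACA.
by rewrite -mulr_sumr orho eq_sym (negbTE kj) mulr0.
Qed.

Lemma tensor2_orthonormal (I J : finType) (rho : J -> I -> R) :
  (forall j k, \sum_i rho j i * rho k i = (j == k)%:R) -> forall j k j' k',
  \sum_(p : I * I) (rho j p.1 * rho k p.2) * (rho j' p.1 * rho k' p.2) =
  ((j == j') && (k == k'))%:R.
Proof.
move=> orho j k j' k'.
transitivity ((\sum_i rho j i * rho j' i) * (\sum_i rho k i * rho k' i)).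
  rewrite big_distrlr pair_bigA /=; apply: eq_bigr => p _; exact: mulrACA.
by rewrite !orho -natrM mulnb.
Qed.

Lemma exists_frame_fun n (w : 'I_n.+1 -> R) : exists rho : 'I_n.+1 -> 'I_n.+1 -> R,
  (forall j k, \sum_i rho j i * rho k i = (j == k)%:R) /\
  (forall j, \sum_i w i * rho j i = if j == ord0 then Num.sqrt (\sum_i w i ^+ 2) else 0).
Proof.
have [rho [orho wrho]] := exists_frame (@ltr01 R) [tuple w i | i < n.+1].
exists (fun j i => tnth (rho j) i); split => [j k|j]; first exact: orho.
rewrite (_ : \sum_i w i ^+ 2 = dot [tuple w i | i < n.+1] [tuple w i | i < n.+1]).
  by rewrite -wrho; apply: eq_bigr => i _; rewrite tnth_mktuple.
by apply: eq_bigr => i _; rewrite tnth_mktuple expr2.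
Qed.

End frame.

Section quadratic.
Context (R : realType).

Definition linear_form n (g : #|'I_n|.-tuple R) (u : 'I_n -> R) :=
  \sum_i ent g i * u i.

(** [G] is a full array with independent entries rather than a symmetric matrix, so its images under
    orthonormal families have a known law. *)
Definition quadratic_form n (G : #|{: 'I_n * 'I_n}|.-tuple R) (u : 'I_n -> R) :=
  \sum_(p : 'I_n * 'I_n) ent G p * (u p.1 * u p.2).

Definition exceeds n (a b c : R) :=
  [set p : #|'I_n|.-tuple R * #|{: 'I_n * 'I_n}|.-tuple R |
    exists2 u, unit_vec u & c < a * linear_form p.1 u + b * quadratic_form p.2 u].

Lemma measurable_linear_form n u : measurable_fun setT (@linear_form n ^~ u).
Proof. by apply: measurable_sum => i; apply: measurable_funM => //; exact: measurable_ent. Qed.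

Lemma measurable_quadratic_form n u : measurable_fun setT (@quadratic_form n ^~ u).
Proof. by apply: measurable_sum => i; apply: measurable_funM => //; exact: measurable_ent. Qed.

Lemma measurable_exceeds n (a b c : R) : measurable (@exceeds n a b c).
Proof.
apply: measurable_sphere_event => [u|[g G] w u wu] /=.
  apply: measurable_funD; apply: measurable_funM => //.
    exact: measurableT_comp (measurable_linear_form u) measurable_fst.
  exact: measurableT_comp (measurable_quadratic_form u) measurable_snd.
apply: cvgD; apply: cvgM; (try exact: cvg_cst); apply: cvg_finsum => i.
  by apply: cvgM; [exact: cvg_cst|exact: wu].
by apply: cvgM; [exact: cvg_cst|apply: cvgM; exact: wu].
Qed.

(** The coordinate vector [(c, s u)] in a frame, with [c] along its distinguished vector; it is a
    unit vector when [u] is one and [c^2 + s^2 = 1]. *)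
Definition extend n (c s : R) (u : 'I_n -> R) (j : 'I_n.+1) : R :=
  if unlift ord0 j is Some k then s * u k else c.

Lemma extend0 n c s (u : 'I_n -> R) : extend c s u ord0 = c.
Proof. by rewrite /extend unlift_none. Qed.

Lemma extendS n c s (u : 'I_n -> R) k : extend c s u (lift ord0 k) = s * u k.
Proof. by rewrite /extend liftK. Qed.

(* Splitting off the direction [rho ord0] leaves a Gaussian form in one
   dimension less: [h] plays the role of [g] and [G'] that of [G]. *)
Lemma quadratic_form_frame n (rho : 'I_n.+1 -> 'I_n.+1 -> R)
    (G : #|{: 'I_n.+1 * 'I_n.+1}|.-tuple R) (c s : R) (u : 'I_n -> R) :
  quadratic_form G (fun i => \sum_j extend c s u j * rho j i) =
  c ^+ 2 * (\sum_p (rho ord0 p.1 * rho ord0 p.2) * ent G p) +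
  Num.sqrt 2 * c * s * linear_form (arr (lin (fun j p =>
    (rho ord0 p.1 * rho (lift ord0 j) p.2 + rho (lift ord0 j) p.1 * rho ord0 p.2) / Num.sqrt 2) G)) u +
  s ^+ 2 * quadratic_form (arr (lin (fun (q : 'I_n * 'I_n) p =>
    rho (lift ord0 q.1) p.1 * rho (lift ord0 q.2) p.2) G)) u.
Proof.
pose X j k := \sum_(p : 'I_n.+1 * 'I_n.+1) (rho j p.1 * rho k p.2) * ent G p.
set U := extend c s u.
transitivity (\sum_j \sum_k U j * U k * X j k).
  rewrite /quadratic_form; under eq_bigr do rewrite big_distrlr /= mulr_sumr.
  rewrite exchange_big; apply: eq_bigr => j _ /=.
  under eq_bigr do rewrite mulr_sumr.
  rewrite exchange_big; apply: eq_bigr => k _ /=.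
  by rewrite /X mulr_sumr; apply: eq_bigr => p _; ring.
rewrite big_ord_recl big_ord_recl /U extend0 -expr2 -!addrA; congr (_ + _).
have -> : linear_form (arr (lin (fun j p =>
    (rho ord0 p.1 * rho (lift ord0 j) p.2 + rho (lift ord0 j) p.1 * rho ord0 p.2) / Num.sqrt 2) G)) u =
    (Num.sqrt 2)^-1 * \sum_j u j * (X ord0 (lift ord0 j) + X (lift ord0 j) ord0).
  rewrite mulr_sumr; apply: eq_bigr => j _; rewrite ent_arr /lin mulrC mulrCA; congr (_ * _).
  rewrite /X -big_split mulr_sumr; apply: eq_bigr => p _ /=.
  by ring.
have -> : quadratic_form (arr (lin (fun (q : 'I_n * 'I_n) p =>
    rho (lift ord0 q.1) p.1 * rho (lift ord0 q.2) p.2) G)) u =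
    \sum_j \sum_k u j * u k * X (lift ord0 j) (lift ord0 k).
  rewrite pair_bigA; apply: eq_bigr => q _; rewrite ent_arr mulrC; congr (_ * _).
have -> (y : R) : Num.sqrt 2 * c * s * ((Num.sqrt 2)^-1 * y) = c * s * y.
  by field; rewrite gt_eqF// sqrtr_gt0.
under [X in _ + X = _]eq_bigr do rewrite big_ord_recl extend0 extendS.
rewrite big_split /= addrA; congr (_ + _).
  rewrite -big_split mulr_sumr; apply: eq_bigr => j _ /=.
  by rewrite extendS; ring.
rewrite mulr_sumr; apply: eq_bigr => j _; rewrite mulr_sumr; apply: eq_bigr => k _.
by rewrite extendS; ring.
Qed.

(** The arithmetic of one recursion level: [q] is [sqrt 2], [N] is [|g|], [z] the coefficient of [G]
    along the split direction, [h] and [Q] the linear and quadratic values at [u']. Since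
    [q / 2 = 1 / q], the [h] and [Q] terms match the recursive bound exactly. The errors of [N] and
    [z] cost at most [r e1 <= e / 4] each, the recursion another [e / 4]. *)
Lemma frame_value_bound (q r c s N z h Q e e1 y : R) :
  0 < q -> q ^+ 2 = 2 -> 1 <= q -> 0 <= r -> 0 <= c -> 0 <= s ->
  c ^+ 2 + s ^+ 2 = 1 -> 0 < e1 -> e1 * (4 * (1 + r)) <= e ->
  q - e1 <= N -> - e1 < z ->
  y * (s ^+ 2 * r) - e / 4 < c * (s ^+ 2 * r) / q * h + s * (s ^+ 2 * r) / 2 * Q ->
  c ^+ 2 * r + y * (s ^+ 2 * r) - e <
    c * r / q * (c * N) + s * r / 2 * (c ^+ 2 * z + q * c * s * h + s ^+ 2 * Q).
Proof.
move=> q2 qq q1 r0 c0 s0 cs e1_gt0 e1_le N_ge ZG FG.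
have s1 : s <= 1.
  by rewrite -(@ler_pXn2r _ 2) ?nnegrE// expr1n -cs lerDr sqr_ge0.
have c1 : c <= 1 by rewrite -(@ler_pXn2r _ 2) ?nnegrE// expr1n -cs lerDl sqr_ge0.
have hq x : x / q = x * q / 2 by rewrite -qq; field; rewrite gt_eqF.
have -> : c * r / q * (c * N) + s * r / 2 * (c ^+ 2 * z + q * c * s * h + s ^+ 2 * Q) =
  c ^+ 2 * r * (N / q) + (s * r / 2 * c ^+ 2) * z +
  (c * (s ^+ 2 * r) / q * h + s * (s ^+ 2 * r) / 2 * Q).
  by rewrite !hq; field.
have hN : 1 - e1 <= N / q.
  by rewrite ler_pdivlMr// mulrBl mul1r; apply: le_trans N_ge; nra.
have c2 : 0 <= c ^+ 2 * r by rewrite mulr_ge0// sqr_ge0.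
have c2r : c ^+ 2 * r <= r by rewrite ler_piMl// exprn_ile1.
have h1 : c ^+ 2 * r - r * e1 <= c ^+ 2 * r * (N / q).
  apply: (@le_trans _ _ (c ^+ 2 * r * (1 - e1))); last exact: ler_wpM2l.
  by rewrite mulrBr mulr1 lerB// ler_wpM2r// ltW.
have t0 : 0 <= s * r / 2 * c ^+ 2 by rewrite mulr_ge0 ?sqr_ge0// divr_ge0 ?mulr_ge0.
have t1 : s * r / 2 * c ^+ 2 <= r.
  have -> : s * r / 2 * c ^+ 2 = s / 2 * (c ^+ 2 * r) by ring.
  by nra.
have h2 : - (r * e1) <= s * r / 2 * c ^+ 2 * z.
  apply: (@le_trans _ _ (s * r / 2 * c ^+ 2 * - e1)).
    by rewrite mulrN lerN2 ler_wpM2r// ltW.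
  by rewrite ler_wpM2l// ltW.
have : 0 <= r * e1 by rewrite mulr_ge0// ltW.
lra.
Qed.

(** Induction on the number of levels with [r], [e] and [del] arbitrary. [K] is fixed before the
    dimension, so each level may have its own error and its own threshold on [v]. *)
Lemma gaussian_form_lower_bound K (r c s : R) :
  0 <= r -> 0 <= c -> 0 <= s -> c ^+ 2 + s ^+ 2 = 1 ->
  forall e del, 0 < e -> 0 < del ->
  exists2 v0, 0 < v0 & forall v n, 0 < v <= v0 -> 2 - v0 <= n%:R * v ->
  ((1 - del)%:E <= (iid (gaussian v) #|'I_n| \x
    iid (gaussian v) #|{: 'I_n * 'I_n}|)%E
      (@exceeds n (c * r / Num.sqrt 2) (s * r / 2) ((1 - s ^+ (2 * K)) * r - e)))%E.
Proof.
move=> r0 c0 s0 cs; have s1 : s <= 1.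
  by rewrite -(@ler_pXn2r _ 2) ?nnegrE// expr1n -cs lerDr sqr_ge0.
have c1 : c <= 1 by rewrite -(@ler_pXn2r _ 2) ?nnegrE// expr1n -cs lerDl sqr_ge0.
have q2 : 0 < Num.sqrt 2 :> R by rewrite sqrtr_gt0.
have qq : Num.sqrt 2 ^+ 2 = 2 :> R by rewrite sqr_sqrtr.
have q1 : 1 <= Num.sqrt 2 :> R by rewrite -[leLHS]sqrtr1 ler_wsqrtr// ler1n.
elim: K r r0 => [|K IH] r r0 e del e0 del0.
  (* At level 0 only a value above [- e] is claimed. The first basis vector attains it: its two
     values are single entries, each above [- e1], with coefficients at most [r]. *)
  pose e1 := e / (2 * (1 + r)).
  have e1_gt0 : 0 < e1 by rewrite divr_gt0// mulr_gt0// ltr_pwDl.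
  pose d1 := Num.min (del / 2) 1.
  have d1_gt0 : 0 < d1 by rewrite lt_min divr_gt0/=.
  have d1_le : d1 <= del / 2 by rewrite ge_min lexx.
  have d1_le1 : d1 <= 1 by rewrite ge_min lexx orbT.
  have [v1 v1_gt0 tail] := gaussian_linear_tail_small e1_gt0 d1_gt0.
  (* The cap 1 contradicts [2 - v0 <= n v] at [n = 0], where there is no unit vector. *)
  exists (Num.min v1 1); first by rewrite lt_min v1_gt0 ltr01.
  move=> v n /andP[v0]; rewrite le_min => /andP[vv1 v1'] nv.
  have {}tail := tail v; rewrite v0 vv1 in tail.
  case: n nv => [|n] nv.
    exfalso; move: nv; have : Num.min v1 1 <= 1 by rewrite ge_min lexx orbT.
    by rewrite mul0r; lra.
  pose A := [set t : #|'I_n.+1|.-tuple R | - e1 < \sum_i (i == ord0)%:R * ent t i].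
  pose B := [set t : #|{: 'I_n.+1 * 'I_n.+1}|.-tuple R |
    - e1 < \sum_i (i == (ord0, ord0))%:R * ent t i].
  have mA : measurable A by exact: measurable_linear_event.
  have mB : measurable B by exact: measurable_linear_event.
  have sumd (I : finType) (i0 : I) (f : I -> R) : \sum_i (i == i0)%:R * f i = f i0.
    rewrite (bigD1 i0)//= eqxx mul1r big1 ?addr0// => i /negbTE ->; exact: mul0r.
  have sumd2 (I : finType) (i0 : I) : \sum_i ((i == i0)%:R : R) ^+ 2 <= 1.
    by under eq_bigr do rewrite expr2; rewrite sumd eqxx.
  apply: (@le_trans _ _ (1 - (d1 + d1))%:E); first by rewrite lee_fin; lra.
  apply: (@product_probability_ge _ _ _ _ _ _ _ A) => //.
  - exact: measurable_exceeds.
  - exact: ltW.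
  - by rewrite ltW.
  - exact: tail.
  move=> g Ag; apply: (le_trans (tail isT _ _ (sumd2 _ (ord0, ord0)))).
  apply: le_measure; rewrite ?inE//.
    by apply: measurable_xsection; exact: measurable_exceeds.
  move=> G; move: Ag; rewrite /xsection /A /= !inE /= !sumd => Ag BG.
  exists (fun i => (i == ord0)%:R).
    by rewrite /unit_vec; under eq_bigr do rewrite expr2; rewrite sumd eqxx.
  have -> : linear_form g (fun i => (i == ord0)%:R) = ent g ord0.
    by rewrite /linear_form; under eq_bigr do rewrite mulrC; rewrite sumd.
  have -> : quadratic_form G (fun i => (i == ord0)%:R) = ent G (ord0, ord0).
    rewrite /quadratic_form -[RHS](sumd _ (ord0, ord0)); apply: eq_bigr => -[i j] _ /=.
    by rewrite mulrC -natrM mulnb.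
  rewrite muln0 expr0 subrr mul0r sub0r.
  have a0 : 0 <= c * r / Num.sqrt 2 by rewrite divr_ge0 ?mulr_ge0// ltW.
  have ar : c * r / Num.sqrt 2 <= r.
    by rewrite ler_pdivrMr//; nra.
  have b0 : 0 <= s * r / 2 by rewrite divr_ge0 ?mulr_ge0.
  have br : s * r / 2 <= r by nra.
  have he : e = 2 * e1 + 2 * (r * e1) by rewrite /e1; field; rewrite gt_eqF// ltr_pwDl.
  have h1 : - (r * e1) <= c * r / Num.sqrt 2 * ent g ord0.
    apply: (@le_trans _ _ (c * r / Num.sqrt 2 * - e1)); first by rewrite mulrN lerN2 ler_wpM2r// ltW.
    by rewrite ler_wpM2l// ltW.
  have h2 : - (r * e1) <= s * r / 2 * ent G (ord0, ord0).
    apply: (@le_trans _ _ (s * r / 2 * - e1)); first by rewrite mulrN lerN2 ler_wpM2r// ltW.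
    by rewrite ler_wpM2l// ltW.
  have : 0 <= r * e1 by rewrite mulr_ge0// ltW.
  lra.
pose r' := s ^+ 2 * r; have r'0 : 0 <= r' by rewrite mulr_ge0// sqr_ge0.
(* The first bound gives [r e1 <= e / 4]; the cap keeps [e1] below 1, as the norm tail requires, and
   below [sqrt 2]. *)
pose e1 := Num.min (e / (4 * (1 + r))) (2^-1).
have e1_gt0 : 0 < e1 by rewrite lt_min divr_gt0 ?mulr_gt0 ?ltr_pwDl//= invr_gt0.
have e1_le : e1 * (4 * (1 + r)) <= e.
  by rewrite -ler_pdivlMr ?mulr_gt0 ?ltr_pwDl// ge_min lexx.
have e1_lt : e1 <= 2^-1 by rewrite ge_min lexx orbT.
(* Three failures share [del]: the norm of [g], the coefficient of [G] along [g], and the recursion.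
   The cap keeps [d1 + d1] at most 1. *)
pose d1 := Num.min (del / 3) (3^-1).
have d1_gt0 : 0 < d1 by rewrite lt_min divr_gt0//= invr_gt0.
have d1_le : d1 <= del / 3 by rewrite ge_min lexx.
have d1_le1 : d1 <= 3^-1 by rewrite ge_min lexx orbT.
have e4 : 0 < e / 4 by rewrite divr_gt0.
have [v1 v1_gt0 tail] := gaussian_linear_tail_small e1_gt0 d1_gt0.
have [v2 v2_gt0 norm_tail] := @gaussian_norm_tail R e1 d1 e1_gt0 ltac:(lra) d1_gt0.
have [v3 v3_gt0 {}IH] := IH r' r'0 (e / 4) d1 e4 d1_gt0.
pose w := Num.min (Num.min v1 v2) (Num.min v3 1).
have w0 : 0 < w by rewrite !lt_min v1_gt0 v2_gt0 v3_gt0 ltr01.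
have [wv1 wv2 wv3 w1] : [/\ w <= v1, w <= v2, w <= v3 & w <= 1].
  by split; rewrite !ge_min lexx ?orbT.
(* Halving pays for the lost dimension: [v <= w / 2] and [(n + 1) v >= 2 - w / 2] give
   [n v >= 2 - w]. *)
exists (w / 2); first by rewrite divr_gt0.
move=> v [|n] /andP[v0 vw] nv; first by exfalso; move: nv; rewrite mul0r; lra.
have {}tail := tail v; rewrite v0 (_ : v <= v1) in tail; last by lra.
have {}norm_tail := norm_tail v #|'I_n.+1|; rewrite v0 (_ : v <= v2) in norm_tail; last by lra.
have {}IH := IH v n; rewrite v0 (_ : v <= v3) in IH; last by lra.
have {}norm_tail := norm_tail isT ltac:(rewrite card_ord; lra).
have {}IH := IH isT ltac:(move: nv; rewrite -[n.+1%:R]natr1 mulrDl mul1r; lra).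
have {}tail := tail isT.
pose A := [set t : #|'I_n.+1|.-tuple R | 2 - e1 < dot t t].
have mA : measurable A by apply: measurable_gt_event; exact: measurable_dot.
apply: (@le_trans _ _ (1 - (d1 + (d1 + d1)))%:E); first by rewrite lee_fin; lra.
apply: (@product_probability_ge _ _ _ _ _ _ _ A) => //.
- exact: measurable_exceeds.
- exact: ltW.
- by rewrite addr_ge0 ?(ltW d1_gt0)//=; lra.
move=> g; rewrite /A /= dot_ent => Ag.
(* On the section over [g] this frame is deterministic, so coefficients of [G] in it are again
   independent Gaussians. *)
have [rho [orho grho]] := exists_frame_fun (ent g).
set N := Num.sqrt _ in grho.
have N_ge : Num.sqrt 2 - e1 <= N.
  have e1q : e1 <= Num.sqrt 2 by lra.
  rewrite -(@ler_pXn2r _ 2) ?nnegrE ?sqrtr_ge0 ?subr_ge0//.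
  rewrite sqr_sqrtr; last by apply: sumr_ge0 => i _; exact: sqr_ge0.
  under [leRHS]eq_bigr do rewrite expr2.
  by apply: le_trans (ltW Ag); rewrite sqrrB qq; nra.
pose aZ (p : 'I_n.+1 * 'I_n.+1) := rho ord0 p.1 * rho ord0 p.2.
(* Both mixed tensors multiply the same [u' j]; their sum has norm [sqrt 2], hence the division.
   This [sqrt 2] reappears in the new linear coefficient. *)
pose ah (j : 'I_n) (p : 'I_n.+1 * 'I_n.+1) := (rho ord0 p.1 * rho (lift ord0 j) p.2 +
  rho (lift ord0 j) p.1 * rho ord0 p.2) / Num.sqrt 2.
pose aG (q : 'I_n * 'I_n) (p : 'I_n.+1 * 'I_n.+1) :=
  rho (lift ord0 q.1) p.1 * rho (lift ord0 q.2) p.2.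
have o2 := tensor2_orthonormal orho.
have oZ : \sum_p aZ p ^+ 2 <= 1.
  by under eq_bigr do rewrite expr2; rewrite o2 eqxx.
have oh j j' : \sum_p ah j p * ah j' p = (j == j')%:R.
  transitivity (2^-1 * (\sum_p (rho ord0 p.1 * rho (lift ord0 j) p.2 +
    rho (lift ord0 j) p.1 * rho ord0 p.2) * (rho ord0 p.1 * rho (lift ord0 j') p.2 +
    rho (lift ord0 j') p.1 * rho ord0 p.2))).
    rewrite mulr_sumr; apply: eq_bigr => p _.
    by rewrite /ah mulrACA -invfM -expr2 qq mulrC.
  under eq_bigr do rewrite mulrDl !mulrDr.
  rewrite !big_split /= !o2 !(inj_eq lift_inj) !eqxx.
  have l0 i : (ord0 == lift (ord0 : 'I_n.+1) i) = false by exact: negbTE (neq_lift _ _).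
  rewrite ?[lift _ _ == ord0]eq_sym !l0 /= ?andbF ?andbT.
  by case: (j == j') => /=; field.
have oG q q' : \sum_p aG q p * aG q' p = (q == q')%:R.
  by rewrite o2 !(inj_eq lift_inj).
have ohG j q : \sum_p ah j p * aG q p = 0.
  transitivity ((Num.sqrt 2)^-1 * \sum_p (rho ord0 p.1 * rho (lift ord0 j) p.2 +
    rho (lift ord0 j) p.1 * rho ord0 p.2) * aG q p).
    by rewrite mulr_sumr; apply: eq_bigr => p _; rewrite /ah mulrAC mulrC.
  under eq_bigr do rewrite mulrDl.
  have l0 i : (ord0 == lift (ord0 : 'I_n.+1) i) = false by exact: negbTE (neq_lift _ _).
  by rewrite big_split /= !o2 !l0 /= ?andbF !addr0 mulr0.
have pp := preserves_lin_cod v0 oh oG ohG.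
set F := (X in preserves _ _ X) in pp.
pose Z := [set t : #|{: 'I_n.+1 * 'I_n.+1}|.-tuple R | - e1 < \sum_p aZ p * ent t p].
have mZ : measurable Z by exact: measurable_linear_event.
set E := exceeds _ _ _ in IH.
have mE : measurable E by exact: measurable_exceeds.
have mFE : measurable (F @^-1` E) by rewrite -[X in measurable X]setTI; exact: pp.1.
(* The recursive bound for the independent pair of smaller arrays becomes an event about [G]
   alone. *)
rewrite -(pp.2 _ mE) in IH.
apply: (le_trans (probability_setI_ge mZ mFE (tail _ _ oZ) IH)).
apply: le_measure; rewrite ?inE//; first exact: measurableI.
  by apply: measurable_xsection; exact: measurable_exceeds.
move=> G [ZG [u u1 FG]]; rewrite /xsection /= inE /=.
exists (fun i => \sum_j extend c s u j * rho j i).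
  rewrite /unit_vec; under eq_bigr do rewrite expr2.
  rewrite (sum_sum_delta _ _ orho) big_ord_recl extend0 -expr2.
  under eq_bigr do rewrite extendS -expr2 exprMn.
  by rewrite -mulr_sumr u1 mulr1.
rewrite quadratic_form_frame.
have -> : linear_form g (fun i => \sum_j extend c s u j * rho j i) = c * N.
  rewrite /linear_form; under eq_bigr do rewrite mulr_sumr.
  rewrite exchange_big /= big_ord_recl [X in _ + X]big1 ?addr0 => [|j _].
    under eq_bigr do rewrite mulrCA.
    by rewrite -mulr_sumr grho eqxx extend0.
  under eq_bigr do rewrite mulrCA.
  by rewrite -mulr_sumr grho eq_sym (negbTE (neq_lift _ _)) mulr0.
move: FG; rewrite /F /= -/ah -/aG.
set h := linear_form _ _; set Q := quadratic_form _ _ => FG.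
rewrite -/aZ; set z := \sum_p _.
have {}ZG : - e1 < z by [].
rewrite (_ : (1 - s ^+ (2 * K.+1)) * r = c ^+ 2 * r + (1 - s ^+ (2 * K)) * r').
  exact: (frame_value_bound q2 qq q1 r0 c0 s0 cs e1_gt0 e1_le N_ge ZG FG).
rewrite /r' mulnS exprD; have -> : c ^+ 2 = 1 - s ^+ 2 by rewrite -cs addrK.
ring.
Qed.

End quadratic.

(** * Low-degree part of a Gaussian tensor *)

Section projection.
Context (R : realType).

Lemma sum_delta_l (I : finType) (i0 : I) (f : I -> R) : \sum_i (i0 == i)%:R * f i = f i0.
Proof.
rewrite (bigD1 i0)//= eqxx mul1r big1 ?addr0// => i; rewrite eq_sym => /negbTE ->.
exact: mul0r.
Qed.

Definition cat_arr (I J : finType) (p : #|I|.-tuple R * #|J|.-tuple R) : #|{: I + J}|.-tuple R :=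
  arr (fun k : I + J => match k with inl i => ent p.1 i | inr j => ent p.2 j end).

Lemma preserves_cat_arr (v : R) (I J : finType) : 0 < v ->
  preserves (iid (gaussian v) #|I| \x iid (gaussian v) #|J|)%E
    (iid (gaussian v) #|{: I + J}|) (@cat_arr I J).
Proof.
move=> v0.
pose a (k : I + J) (i : I) : R := if k is inl i' then (i' == i)%:R else 0.
pose b (k : I + J) (j : J) : R := if k is inr j' then (j' == j)%:R else 0.
have oab k k' : \sum_i a k i * a k' i + \sum_i b k i * b k' i = (k == k')%:R.
  case: k k' => [i|j] [i'|j'] /=; rewrite ?sum_delta_l.
  - by rewrite big1 ?addr0 1?eq_sym// => j _; rewrite mul0r.
  - by rewrite !big1 ?addr0// => *; rewrite ?mul0r ?mulr0.
  - by rewrite !big1 ?addr0// => *; rewrite ?mul0r ?mulr0.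
  - by rewrite big1 ?add0r 1?eq_sym// => i _; rewrite mul0r.
have := preserves_lin_dom v0 oab.
set F := (X in preserves _ _ X); suff -> : F = @cat_arr I J by [].
apply/funext => p; rewrite /F /cat_arr; congr arr; apply/funext => -[i|j].
  rewrite /lin /= sum_delta_l big1 ?addr0// => j _; exact: mul0r.
rewrite /lin /= sum_delta_l big1 ?add0r// => i _; exact: mul0r.
Qed.

Section family.
Context (J K : finType) (a : J -> K -> R).
Hypothesis oa : forall j j', \sum_k a j k * a j' k = (j == j')%:R.

(** The matrix of the orthogonal projection onto the complement of the span of the rows of [a];
    [residual] applies this projection to [T]. *)
Definition coproj (k k' : K) : R := (k == k')%:R - \sum_j a j k * a j k'.

Definition residual (T : K -> R) (k : K) := T k - \sum_j a j k * \sum_k' a j k' * T k'.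

(** With [P] the projection onto the span, [I - P] is symmetric and idempotent, so the left side is
    [P + (I - P) = I]. *)
Lemma coproj_rows k k' : \sum_j a j k * a j k' + \sum_l coproj k l * coproj k' l = (k == k')%:R.
Proof.
set P := fun k l => \sum_j a j k * a j l.
have PP : \sum_l P k l * P k' l = P k k'.
  rewrite /P; under eq_bigr do rewrite big_distrlr /=.
  rewrite exchange_big; apply: eq_bigr => j _; rewrite exchange_big /=.
  rewrite (bigD1 j)//= [X in _ + X]big1 => [|j' jj].
    under eq_bigr do rewrite mulrACA.
    by rewrite -mulr_sumr oa eqxx mulr1 addr0.
  under eq_bigr do rewrite mulrACA.
  by rewrite -mulr_sumr oa eq_sym (negbTE jj) mulr0.
have -> : \sum_l coproj k l * coproj k' l = \sum_l ((k == l)%:R * ((k' == l)%:R - P k' l)) -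
    (\sum_l (k' == l)%:R * P k l) + \sum_l P k l * P k' l.
  rewrite -sumrB -big_split; apply: eq_bigr => l _ /=; rewrite /coproj -/(P _ _) -/(P _ _); ring.
rewrite !sum_delta_l PP [k' == k]eq_sym -/(P k k').
have -> : P k' k = P k k' by apply: eq_bigr => j _; exact: mulrC.
ring.
Qed.

Lemma residual_norm (T : K -> R) : \sum_k residual T k ^+ 2 <= \sum_k T k ^+ 2.
Proof.
pose t j := \sum_k a j k * T k.
have st : \sum_k (\sum_j a j k * t j) * T k = \sum_j t j ^+ 2.
  under eq_bigr do rewrite mulr_suml.
  rewrite exchange_big; apply: eq_bigr => j _ /=.
  under eq_bigr do rewrite mulrAC mulrC.
  by rewrite -mulr_sumr expr2.
have ss : \sum_k (\sum_j a j k * t j) ^+ 2 = \sum_j t j ^+ 2.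
  under eq_bigr do (rewrite expr2; under eq_bigr do rewrite mulrC).
  by rewrite (sum_sum_delta _ _ oa); apply: eq_bigr => j _; rewrite expr2.
have -> : \sum_k residual T k ^+ 2 = \sum_k T k ^+ 2 -
    2 * (\sum_k (\sum_j a j k * t j) * T k) + \sum_k (\sum_j a j k * t j) ^+ 2.
  rewrite mulr_sumr -sumrB -big_split; apply: eq_bigr => k _ /=.
  by rewrite /residual -/(t _); ring.
rewrite st ss; have : 0 <= \sum_j t j ^+ 2 by apply: sumr_ge0 => j _; exact: sqr_ge0.
lra.
Qed.

(** Prescribed coefficients [p.1] along the family plus the projection of an independent copy [p.2].
    It realizes conditioning a Gaussian array on its coefficients as a product measure. *)
Definition recompose (p : #|J|.-tuple R * #|K|.-tuple R) : #|K|.-tuple R :=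
  arr (fun k => lin (fun k j => a j k) p.1 k + lin coproj p.2 k).

Lemma preserves_recompose (v : R) : 0 < v ->
  preserves (iid (gaussian v) #|J| \x iid (gaussian v) #|K|)%E
    (iid (gaussian v) #|K|) recompose.
Proof. by move=> v0; exact: (preserves_lin_dom (a := fun k j => a j k) v0 coproj_rows). Qed.

Lemma sum_recompose (p : #|J|.-tuple R * #|K|.-tuple R) (T : K -> R) :
  \sum_k ent (recompose p) k * T k =
  \sum_j ent p.1 j * (\sum_k a j k * T k) + \sum_k residual T k * ent p.2 k.
Proof.
under eq_bigr do rewrite ent_arr mulrDl.
rewrite big_split /=; congr (_ + _).
  under eq_bigr do rewrite /lin mulr_suml.
  rewrite exchange_big; apply: eq_bigr => j _ /=; rewrite mulr_sumr.
  by apply: eq_bigr => k _; ring.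
under eq_bigr do rewrite /lin mulr_suml.
rewrite exchange_big; apply: eq_bigr => l _ /=.
transitivity ((\sum_k (l == k)%:R * T k - \sum_k \sum_j a j k * a j l * T k) * ent p.2 l).
  rewrite -sumrB mulr_suml; apply: eq_bigr => k _.
  by rewrite /coproj eq_sym -mulr_suml; ring.
rewrite sum_delta_l /residual; congr ((_ - _) * _).
rewrite exchange_big; apply: eq_bigr => j _; rewrite mulr_sumr.
by apply: eq_bigr => k _; ring.
Qed.

End family.

End projection.

(** * Tensor basis adapted to a frame *)

Section tensors.
Context (R : realType) (d n : nat).
Notation K := (multi_index d n.+1).

Definition basis_tensor (rho : 'I_n.+1 -> 'I_n.+1 -> R) (tau kappa : K) :=
  \prod_(k < d) rho (tau k) (kappa k).

Definition single_idx (j : 'I_n) (p : 'I_d) : K :=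
  [ffun k => if k == p then lift ord0 j else ord0].

(** Used with [p.1 < p.2]: each placement of the ordered pair [q] into two slots then occurs once,
    which makes the indexing injective. *)
Definition double_idx (q : 'I_n * 'I_n) (p : 'I_d * 'I_d) : K :=
  [ffun k => if k == p.1 then lift ord0 q.1
             else if k == p.2 then lift ord0 q.2 else ord0].

Lemma lift0_neq0 (j : 'I_n) : lift ord0 j <> ord0 :> 'I_n.+1.
Proof. by apply/eqP; rewrite eq_sym neq_lift. Qed.

Lemma single_idx_inj j j' p p' : (single_idx j p == single_idx j' p') = (j == j') && (p == p').
Proof.
apply/eqP/andP => [/ffunP e|[/eqP -> /eqP ->]//].
have := e p; rewrite !ffunE eqxx; case: eqP => [pp /lift_inj ->|_ /lift0_neq0//].
by rewrite eqxx.
Qed.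

Lemma double_idx_inj (q q' : 'I_n * 'I_n) (p p' : 'I_d * 'I_d) :
  (p.1 < p.2)%N -> (p'.1 < p'.2)%N ->
  (double_idx q p == double_idx q' p') = (q == q') && (p == p').
Proof.
case: p p' => [p1 p2] [p1' p2'] /= p12 p12'.
apply/eqP/andP => [/ffunP e|[/eqP -> /eqP ->]//].
have n12 : (p2 == p1) = false by apply/eqP => h; rewrite h ltnn in p12.
have n12' : (p2' == p1') = false by apply/eqP => h; rewrite h ltnn in p12'.
have h1 : (p1 == p1') || (p1 == p2').
  by have := e p1; rewrite !ffunE /= eqxx; case: eqP => //; case: eqP.
have h2 : (p2 == p1') || (p2 == p2').
  by have := e p2; rewrite !ffunE /= eqxx n12; case: eqP => //; case: eqP.
have e1 : p1 = p1'.
  case/orP: h1 => /eqP // h1; case/orP: h2 => /eqP h2.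
    by move: p12; rewrite h1 h2 ltnNge ltnW.
  by move: p12; rewrite h1 h2 ltnn.
have e2 : p2 = p2' by case/orP: h2 => /eqP // h2; move: n12; rewrite h2 e1 eqxx.
rewrite e1 e2 eqxx; split => //; move: (e p1) (e p2).
rewrite !ffunE /= -e1 -e2 !eqxx n12 => /lift_inj f1 /lift_inj f2.
by case: q q' f1 f2 {e} => ? ? [? ?] /= -> ->.
Qed.

Lemma single_double_neq j q p (p' : 'I_d * 'I_d) : (p'.1 < p'.2)%N -> (single_idx j p == double_idx q p') = false.
Proof.
case: p' => p1 p2 /= p12; apply/eqP => /ffunP e; move: (e p1) (e p2).
have n12 : (p2 == p1) = false by apply/eqP => h; rewrite h ltnn in p12.
rewrite !ffunE /= !eqxx n12; case: eqP => [<- _|_ /esym/lift0_neq0//].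
by rewrite n12 => /esym/lift0_neq0.
Qed.

Context (rho : 'I_n.+1 -> 'I_n.+1 -> R).
Hypothesis orho : forall j k, \sum_i rho j i * rho k i = (j == k)%:R.

Lemma basis_tensor_orthonormal tau tau' :
  \sum_(kappa : K) basis_tensor rho tau kappa * basis_tensor rho tau' kappa = (tau == tau')%:R.
Proof.
under eq_bigr do rewrite /basis_tensor -big_split /=.
rewrite -(bigA_distr_bigA (fun k i => rho (tau k) i * rho (tau' k) i)).
under eq_bigr do rewrite orho.
case: eqP => [->|ne]; first by apply: big1 => k _; rewrite eqxx.
have [k kne] : exists k, tau k != tau' k.
  apply/existsP; apply: contraT; rewrite negb_exists => /forallP h.
  by case: ne; apply/ffunP => k; apply/eqP; have := h k; rewrite negbK.
by rewrite (bigD1 k)//= (negbTE kne) mul0r.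
Qed.

Lemma basis_tensor_pow (U : 'I_n.+1 -> R) tau :
  \sum_(kappa : K) basis_tensor rho tau kappa *
     \prod_(k < d) (\sum_j U j * rho j (kappa k)) = \prod_(k < d) U (tau k).
Proof.
under eq_bigr do rewrite /basis_tensor -big_split /=.
rewrite -(bigA_distr_bigA (fun k i => rho (tau k) i * \sum_j U j * rho j i)).
apply: eq_bigr => k _; under eq_bigr do rewrite mulr_sumr.
rewrite exchange_big /= (bigD1 (tau k))//= [X in _ + X]big1 => [|j jk].
  under eq_bigr do rewrite mulrCA.
  by rewrite -mulr_sumr orho eqxx mulr1 addr0.
under eq_bigr do rewrite mulrCA.
by rewrite -mulr_sumr orho eq_sym (negbTE jk) mulr0.
Qed.

Lemma prod_single (c s : R) u j p : \prod_(k < d) extend c s u (single_idx j p k) = c ^+ d.-1 * (s * u j).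
Proof.
rewrite (bigD1 p)//= !ffunE eqxx extendS mulrC; congr (_ * _).
under eq_bigr => k kp do rewrite ffunE (negbTE kp) extend0.
by rewrite prodr_const cardC1 card_ord.
Qed.

Lemma prod_double (c s : R) u q (p : 'I_d * 'I_d) : (p.1 < p.2)%N ->
  \prod_(k < d) extend c s u (double_idx q p k) = c ^+ d.-2 * (s ^+ 2 * (u q.1 * u q.2)).
Proof.
move=> p12; have n12 : p.2 != p.1 by apply/eqP => h; rewrite h ltnn in p12.
rewrite (bigD1 p.1)//= (bigD1 p.2)//= !ffunE eqxx (negbTE n12) eqxx !extendS.
under eq_bigr => k /andP[k1 k2] do rewrite ffunE (negbTE k1) (negbTE k2) extend0.
rewrite prodr_const (_ : #|_| = d.-2); first by ring.
have := cardD1 p.2 (predC1 p.1); rewrite cardC1 card_ord !inE n12.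
move=> h; transitivity #|[predD1 predC1 p.1 & p.2]|; last by rewrite h.
by apply: eq_card => k; rewrite /in_mem /= andbC.
Qed.

Definition pairs : pred ('I_d * 'I_d) := [pred p : 'I_d * 'I_d | (p.1 < p.2)%N].

Lemma card_pairs : (#|pairs|%:R : R) = d%:R * (d%:R - 1) / 2.
Proof.
have E : #|pairs|%:R = \sum_(p < d) \sum_(q < d) (p < q)%N%:R :> R.
  rewrite pair_bigA -sum1_card natr_sum big_mkcond; apply: eq_bigr => p _ /=.
  by have -> : (p \in pairs) = (p.1 < p.2)%N by []; case: (_ < _)%N.
have E' : #|pairs|%:R = \sum_(p < d) \sum_(q < d) (q < p)%N%:R :> R.
  by rewrite E exchange_big.
have E0 : d%:R = \sum_(p < d) \sum_(q < d) (p == q)%:R :> R.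
  rewrite -[in LHS](card_ord d) -sum1_card natr_sum; apply: eq_bigr => p _.
  by rewrite (bigD1 p)//= eqxx big1 ?addr0// => q; rewrite eq_sym => /negbTE ->.
have E1 : d%:R * d%:R = \sum_(p < d) \sum_(q < d) 1 :> R.
  by rewrite !sumr_const card_ord -[1 *+ d *+ d]mulr_natl.
have : d%:R * d%:R = #|pairs|%:R + #|pairs|%:R + d%:R :> R.
  rewrite E1 {1}E E' E0 -!big_split; apply: eq_bigr => p _.
  rewrite -!big_split; apply: eq_bigr => q _ /=; rewrite -val_eqE /=.
  by case: ltngtP => _; rewrite !(addr0, add0r).
lra.
Qed.

(** Sums, over the slots, of basis tensors with exactly one or two factors off [rho ord0], divided
    by the square root of the number of terms. The coefficients of the noise along them are the [g]
    and [G] of the random field. *)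
Definition low_degree_family (k : 'I_n + ('I_n * 'I_n)) (kappa : K) : R :=
  match k with
  | inl j => (Num.sqrt d%:R)^-1 * \sum_p basis_tensor rho (single_idx j p) kappa
  | inr q => (Num.sqrt #|pairs|%:R)^-1 * \sum_(p in pairs) basis_tensor rho (double_idx q p) kappa
  end.

Lemma low_degree_family_orthonormal : (2 <= d)%N -> forall k k',
  \sum_kappa low_degree_family k kappa * low_degree_family k' kappa = (k == k')%:R.
Proof.
move=> d2; have d0 : 0 < d%:R :> R by rewrite ltr0n; lia.
have p0 : 0 < #|pairs|%:R :> R.
  rewrite card_pairs divr_gt0// mulr_gt0// subr_gt0 ltr1n; lia.
have E (S S' : finType) (D : {pred S}) (D' : {pred S'}) (f : S -> K) (f' : S' -> K) (x y : R) :
    \sum_kappa (x * \sum_(p in D) basis_tensor rho (f p) kappa) *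
     (y * \sum_(p in D') basis_tensor rho (f' p) kappa) =
    x * y * \sum_(p in D) \sum_(p' in D') (f p == f' p')%:R.
  under eq_bigr do rewrite mulrACA big_distrlr /=.
  rewrite -mulr_sumr exchange_big; congr (_ * _); apply: eq_bigr => p _ /=.
  rewrite exchange_big; apply: eq_bigr => p' _ /=.
  exact: basis_tensor_orthonormal.
have D (S : finType) (A : {pred S}) (b : bool) :
    \sum_(p in A) \sum_(p' in A) (b && (p == p'))%:R = b%:R * #|A|%:R :> R.
  rewrite -sum1_card natr_sum mulr_sumr; apply: eq_bigr => p pA.
  rewrite (bigD1 p)//= eqxx andbT big1 ?addr0 ?mulr1// => p' /andP[_ pp].
  by rewrite eq_sym (negbTE pp) andbF.
have Q (x : R) : 0 < x -> (Num.sqrt x)^-1 * (Num.sqrt x)^-1 * x = 1.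
  by move=> x0; rewrite -invfM -expr2 sqr_sqrtr ?mulVf ?gt_eqF ?ltW.
case=> [j|q] [j'|q'] /=.
- rewrite (E _ _ xpredT xpredT).
  under eq_bigr do under eq_bigr do rewrite single_idx_inj.
  rewrite D (_ : #|_| = d); last by rewrite -[RHS]card_ord; apply: eq_card.
  by rewrite mulrCA Q// mulr1.
- rewrite (E _ _ xpredT (mem pairs)) [X in _ * X]big1 ?mulr0// => p _.
  by rewrite big1// => p'; rewrite inE => h; rewrite single_double_neq.
- rewrite (E _ _ (mem pairs) xpredT) [X in _ * X]big1 ?mulr0// => p; rewrite inE => h.
  by rewrite big1// => p' _; rewrite eq_sym single_double_neq.
- rewrite (E _ _ (mem pairs) (mem pairs)).
  under eq_bigr => p hp do under eq_bigr => p' hp' do rewrite (double_idx_inj q q' hp hp').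
  by rewrite D mulrCA Q// mulr1.
Qed.

(** All terms of the sum over slots pair equally with the pure power; [N] equal terms over [sqrt N]
    leave [sqrt N], with [N = d] or [d (d - 1) / 2]. This is the origin of the coefficients [a] and
    [b]. *)
Lemma low_degree_family_pow (c s : R) u k : (2 <= d)%N ->
  \sum_(kappa : K) low_degree_family k kappa *
     \prod_(i < d) (\sum_j extend c s u j * rho j (kappa i)) =
  match k with
  | inl j => Num.sqrt d%:R * c ^+ d.-1 * s * u j
  | inr q => Num.sqrt (d%:R * (d%:R - 1) / 2) * c ^+ d.-2 * s ^+ 2 * (u q.1 * u q.2)
  end.
Proof.
move=> d2; have d0 : 0 < d%:R :> R by rewrite ltr0n; lia.
have p0 : 0 < #|pairs|%:R :> R.
  rewrite card_pairs divr_gt0// mulr_gt0// subr_gt0 ltr1n; lia.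
have Q (x : R) : 0 < x -> (Num.sqrt x)^-1 * x = Num.sqrt x.
  by move=> x0; rewrite -{2}(sqr_sqrtr (ltW x0)) expr2 mulKf// gt_eqF// sqrtr_gt0.
case: k => [j|q] /=.
  under eq_bigr do rewrite -mulrA mulr_suml.
  rewrite -mulr_sumr exchange_big /=.
  under eq_bigr do rewrite basis_tensor_pow prod_single.
  by rewrite sumr_const card_ord -[(_ * _) *+ d]mulr_natl [LHS]mulrA Q// !mulrA.
under eq_bigr do rewrite -mulrA mulr_suml.
rewrite -mulr_sumr exchange_big /=.
under eq_bigr => p do [rewrite inE => hp; rewrite basis_tensor_pow (prod_double _ _ _ _ hp)].
by rewrite sumr_const -[(_ * _) *+ _]mulr_natl [LHS]mulrA Q// card_pairs !mulrA.
Qed.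

End tensors.

(** * The spiked tensor *)

Section spiked.
Context (R : realType).

(** Under the root, the summand [M] of [M (1 + M)] produces [2 a^2], the degree-one part, and [M^2]
    produces [4 b^2], the degree-two part. *)
Lemma L_objective_noise d (lambda m : R) : (2 <= d)%N -> 0 < m <= 1 ->
  L_objective d lambda m = lambda * m ^+ d +
    Num.sqrt (2 * (Num.sqrt d%:R * m ^+ d.-1 * Num.sqrt (1 - m ^+ 2)) ^+ 2 +
      4 * (Num.sqrt (d%:R * (d%:R - 1) / 2) * m ^+ d.-2 * Num.sqrt (1 - m ^+ 2) ^+ 2) ^+ 2).
Proof.
move=> d2 /andP[m0 m1].
have m2 : m ^+ 2 <= 1 by rewrite exprn_ile1// ltW.
have d1 : 0 < d%:R - 1 :> R by rewrite subr_gt0 ltr1n.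
have d0 : 0 < d%:R :> R by rewrite ltr0n; lia.
have m0' : m != 0 by rewrite gt_eqF.
have E2 : m ^+ d = m ^+ d.-2 * m ^+ 2 by rewrite -exprD; congr (_ ^+ _); lia.
have E1 : m ^+ d.-1 = m ^+ d.-2 * m by rewrite -exprSr; congr (_ ^+ _); lia.
rewrite /L_objective E2 E1; have := exprn_gt0 d.-2 m0; set y := m ^+ d.-2 => y0.
rewrite mulrDr mulrC; congr (_ + _).
set M := (d%:R - 1) * _.
have M0 : 0 <= M by rewrite mulr_ge0 ?(ltW d1)// divr_ge0 ?sqr_ge0// subr_ge0.
rewrite -sqrtrM; last by rewrite divr_ge0 ?mulr_ge0 ?ltW.
have ym : 0 < y * m ^+ 2 by rewrite mulr_gt0// exprn_gt0.
rewrite -[y * m ^+ 2]gtr0_norm// -sqrtr_sqr -sqrtrM ?sqr_ge0//; congr Num.sqrt.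
set A := Num.sqrt d%:R; set B := Num.sqrt (_ / 2); set S := Num.sqrt (1 - _).
have A2 : A ^+ 2 = d%:R by rewrite sqr_sqrtr// ltW.
have B2 : B ^+ 2 = d%:R * (d%:R - 1) / 2.
  by rewrite sqr_sqrtr// divr_ge0// mulr_ge0// ltW.
have S2 : S ^+ 2 = 1 - m ^+ 2 by rewrite sqr_sqrtr// subr_ge0.
transitivity (2 * (A ^+ 2 * (y * m) ^+ 2 * S ^+ 2) + 4 * (B ^+ 2 * y ^+ 2 * (S ^+ 2) ^+ 2)).
  rewrite A2 B2 S2 /M; field.
  by rewrite m0' gt_eqF.
by ring.
Qed.

Lemma L_objective_le0 d (lambda m : R) : (1 <= d)%N -> 0 <= lambda ->
  m = 0 \/ m = 1 -> L_objective d lambda m <= lambda.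
Proof.
case: d => // d _ l0 [->|->]; rewrite /L_objective.
  by rewrite expr0n /= mul0r.
by rewrite !expr1n subrr mul0r mulr0 mul0r sqrtr0 mulr0 addr0 mul1r.
Qed.

(** The form of the spiked tensor at [v], written with the unsymmetrized array [W]. *)
Definition spiked_value d n (lambda : R) (x : n.-tuple R) (W : tensor R d n) (v : 'I_n -> R) :=
  lambda * (\sum_i tnth x i * v i) ^+ d +
  \sum_(kappa : multi_index d n) ent W kappa * \prod_(k < d) v (kappa k).

Lemma measurable_spiked_value d n (lambda : R) (x : n.-tuple R) (c : R) :
  measurable [set W : tensor R d n | exists2 v, unit_vec v & c < spiked_value lambda x W v].
Proof.
apply: measurable_sphere_event => [v|W w v wv].
  apply: measurable_funD => //; apply: measurable_sum => i.
  by apply: measurable_funM => //; exact: measurable_ent.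
apply: cvgD.
  apply: cvgM; first exact: cvg_cst.
  have E (t : R) : t ^+ d = \prod_(k < d) t by rewrite prodr_const card_ord.
  rewrite E; under eq_fun do rewrite E.
  apply: cvg_finprod => _; apply: cvg_finsum => i.
  by apply: cvgM; [exact: cvg_cst|exact: wv].
apply: cvg_finsum => kappa; apply: cvgM; first exact: cvg_cst.
by apply: cvg_finprod => k; exact: wv.
Qed.

(** The threshold [N] is chosen before [x]; this uniformity is what integration over the prior
    requires. *)
Lemma spiked_value_lower_bound d (lambda m : R) : (2 <= d)%N -> 0 < m < 1 ->
  forall e del, 0 < e -> 0 < del -> exists N, forall n, (N <= n)%N ->
  forall x : n.-tuple R, unit_sphere n x ->
  ((1 - del)%:E <= gaussian_tensor d n [set W |
    exists2 v, unit_vec v & (L_objective d lambda m - e < spiked_value lambda x W v)%R])%E.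
Proof.
move=> d2 /andP[m0 m1] e del e0 del0.
set s := Num.sqrt (1 - m ^+ 2).
have m2 : m ^+ 2 < 1 by rewrite exprn_ilt1// ?ltW.
have s0 : 0 < s by rewrite sqrtr_gt0 subr_gt0.
have s2 : s ^+ 2 = 1 - m ^+ 2 by rewrite sqr_sqrtr// subr_ge0 ltW.
have d0 : 0 < d%:R :> R by rewrite ltr0n; lia.
have d1 : 0 < d%:R - 1 :> R by rewrite subr_gt0 ltr1n.
set a := Num.sqrt d%:R * m ^+ d.-1 * s.
set b := Num.sqrt (d%:R * (d%:R - 1) / 2) * m ^+ d.-2 * s ^+ 2.
have a0 : 0 < a.
  by apply: mulr_gt0 => //; apply: mulr_gt0; rewrite ?sqrtr_gt0 ?exprn_gt0.
have b0 : 0 < b.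
  apply: mulr_gt0; last exact: exprn_gt0.
  by apply: mulr_gt0; rewrite ?sqrtr_gt0 ?exprn_gt0// divr_gt0 ?mulr_gt0.
have LE : L_objective d lambda m = lambda * m ^+ d + Num.sqrt (2 * a ^+ 2 + 4 * b ^+ 2).
  by apply: L_objective_noise => //; rewrite m0 ltW.
set r := Num.sqrt (2 * a ^+ 2 + 4 * b ^+ 2) in LE.
have r2 : r ^+ 2 = 2 * a ^+ 2 + 4 * b ^+ 2.
  by rewrite sqr_sqrtr// addr_ge0// mulr_ge0// sqr_ge0.
have r0 : 0 < r by rewrite sqrtr_gt0 addr_gt0// mulr_gt0// exprn_gt0.
have q2 : 0 < Num.sqrt 2 :> R by rewrite sqrtr_gt0.
have qq : Num.sqrt 2 ^+ 2 = 2 :> R by rewrite sqr_sqrtr.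
(* Normalizing [(sqrt 2 a, 2 b)] to the unit circle puts the field into the self-similar form of the
   recursion. *)
pose c := Num.sqrt 2 * a / r; pose t := 2 * b / r.
have c0 : 0 < c by rewrite divr_gt0// mulr_gt0.
have t0 : 0 < t by rewrite divr_gt0// mulr_gt0.
have ct : c ^+ 2 + t ^+ 2 = 1.
  have -> : c ^+ 2 + t ^+ 2 = (Num.sqrt 2 ^+ 2 * a ^+ 2 + 4 * b ^+ 2) / r ^+ 2.
    by rewrite /c /t; field; rewrite gt_eqF.
  by rewrite qq -r2 mulfV// gt_eqF// exprn_gt0.
have t1 : t < 1.
  by rewrite -(@ltr_pXn2r _ 2) ?nnegrE ?ltW// expr1n -ct ltrDr exprn_gt0.
have aE : c * r / Num.sqrt 2 = a.
  by rewrite /c divfK ?gt_eqF// mulrC mulKf// gt_eqF.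
have bE : t * r / 2 = b by rewrite /t divfK ?gt_eqF// mulrC mulKf.
(* [t < 1] because [a > 0], so finitely many levels collect all but [e / 4] of [r]; the recursion
   and the residual cost [e / 4] each. *)
have [Kc tK] : exists Kc, t ^+ (2 * Kc) * r < e / 4.
  have : (t ^+ 2) ^+ k * r @[k --> \oo] --> (0 : R).
    rewrite -[X in _ --> X](mul0r r); apply: cvgM; last exact: cvg_cst.
    by apply: cvg_expr; rewrite ger0_norm ?sqr_ge0// exprn_ilt1// ltW.
  move=> /cvgr_lt /(_ (e / 4)); rewrite divr_gt0// => /(_ isT) h.
  near \oo => k; exists k; rewrite exprM; near: k; exact: h.
have e4 : 0 < e / 4 by rewrite divr_gt0.
pose d' := Num.min (del / 2) (1 / 2).
have d'0 : 0 < d' by rewrite lt_min !divr_gt0.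
have d'1 : d' <= del / 2 by rewrite ge_min lexx.
have d'2 : d' <= 1 / 2 by rewrite ge_min lexx orbT.
have d'3 : 1 - del <= 1 - (d' + d') by clear - d'1; lra.
have d'4 : d' <= 1 by clear - d'2; lra.
have [v1 v1_gt0 form] := gaussian_form_lower_bound Kc (ltW r0) (ltW c0) (ltW t0) ct e4 d'0.
have [v2 v2_gt0 tail] := gaussian_linear_tail_small e4 d'0.
exists (Num.truncn (2 / Num.min v1 v2)).+1 => -[//|n] nN x Sx.
have vmin : 0 < Num.min v1 v2 by rewrite lt_min v1_gt0.
set v := 2 / n.+1%:R : R.
have v0 : 0 < v by rewrite divr_gt0.
have vle : v <= Num.min v1 v2.
  rewrite /v ler_pdivrMr// mulrC -ler_pdivrMr//; apply: ltW.
  by apply: (lt_le_trans (truncnS_gt _)); rewrite ler_nat.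
have [vv1 vv2] : v <= v1 /\ v <= v2 by move: vle; rewrite le_min => /andP[].
(* The field lives on the complement of [x], of dimension [n] inside [n + 1], hence
   [n v = 2 - v]. *)
have nv : 2 - v1 <= n%:R * v.
  have : n.+1%:R * v = 2 by rewrite /v mulrC divfK.
  rewrite -[n.+1%:R]natr1 mulrDl mul1r; lra.
have {}form : ((1 - d')%:E <= (iid (gaussian v) #|'I_n| \x
    iid (gaussian v) #|{: 'I_n * 'I_n}|)%E (@exceeds R n a b (r - e / 2)))%E.
  apply: le_trans (form v n _ nv) _; first by rewrite v0.
  rewrite aE bE; apply: le_measure; rewrite ?inE; try exact: measurable_exceeds.
  move=> p [u u1 hu]; exists u => //; apply: le_lt_trans hu.
  by rewrite mulrBl mul1r; lra.
have {}tail := tail v; rewrite v0 vv2 in tail; have {}tail := tail isT.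
have [rho [orho xrho]] := exists_frame_fun (tnth x).
have x1 : Num.sqrt (\sum_i tnth x i ^+ 2) = 1 by rewrite Sx sqrtr1.
pose fam := @low_degree_family R d n rho.
have ofam : forall k k', \sum_kappa fam k kappa * fam k' kappa = (k == k')%:R.
  exact: low_degree_family_orthonormal.
have p1 := preserves_prod (preserves_cat_arr 'I_n ('I_n * 'I_n)%type v0)
  (preserves_id (iid (gaussian v) #|{: multi_index d n.+1}|)).
(* The noise array is realized from independent [g], [G] and a third array that enters only through
   the residual. *)
have pF := preserves_comp p1 (preserves_recompose ofam v0).
set F := (_ \o _) in pF.
set E := [set W | _].
have mE : measurable E by exact: measurable_spiked_value.
rewrite /gaussian_tensor -/v -(pF.2 _ mE).
apply: (@le_trans _ _ (1 - (d' + d'))%:E); first by rewrite lee_fin.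
apply: (@product_probability_ge _ _ _ _ _ _ _ (exceeds a b (r - e / 2))) => //.
- exact: measurable_exceeds.
- by rewrite -[X in measurable X]setTI; exact: pF.1.
- exact: ltW.
- by rewrite ltW.
move=> [g G] [u u1 /= gG].
pose w i := \sum_j extend m s u j * rho j i.
pose T (kappa : multi_index d n.+1) := \prod_(k < d) w (kappa k).
have w1 : unit_vec w.
  rewrite /unit_vec; under eq_bigr do rewrite expr2.
  rewrite (sum_sum_delta _ _ orho) big_ord_recl extend0 -expr2.
  under eq_bigr do rewrite extendS -expr2 exprMn.
  by rewrite -mulr_sumr u1 mulr1 s2 addrC subrK.
have xw : \sum_i tnth x i * w i = m.
  rewrite /w; under eq_bigr do rewrite mulr_sumr.
  rewrite exchange_big /= big_ord_recl [X in _ + X]big1 ?addr0 => [|j _].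
    under eq_bigr do rewrite mulrCA.
    by rewrite -mulr_sumr xrho eqxx x1 mulr1 extend0.
  under eq_bigr do rewrite mulrCA.
  by rewrite -mulr_sumr xrho eq_sym (negbTE (neq_lift _ _)) mulr0.
have T1 : \sum_kappa T kappa ^+ 2 = 1.
  transitivity (\sum_(kappa : multi_index d n.+1) \prod_(k < d) w (kappa k) ^+ 2).
    by apply: eq_bigr => kappa _; rewrite /T -prodrXl.
  rewrite -(bigA_distr_bigA (fun (k : 'I_d) i => w i ^+ 2)).
  by apply: big1 => k _; exact: w1.
apply: (le_trans (tail _ (residual fam T) _)).
  by apply: (le_trans (residual_norm ofam T)); rewrite T1.
apply: le_measure; rewrite ?inE.
- exact: measurable_linear_event.
- apply: measurable_xsection; rewrite -[X in measurable X]setTI; exact: pF.1.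
move=> Y hY; rewrite /xsection /= inE; exists w => //.
have famT k := low_degree_family_pow orho m s u k d2.
have SE : \sum_kappa ent (F ((g, G), Y)) kappa * T kappa = a * linear_form g u +
    b * quadratic_form G u + \sum_kappa residual fam T kappa * ent Y kappa.
  apply: (etrans (sum_recompose fam (cat_arr (g, G), Y) T)); congr (_ + _).
  rewrite big_sumType; congr (_ + _); rewrite mulr_sumr; apply: eq_bigr => i _.
    rewrite famT [X in X * _](ent_arr _ (inl i)); exact: mulrCA.
  rewrite famT [X in X * _](ent_arr _ (inr i)); exact: mulrCA.
rewrite /spiked_value xw; rewrite [X in _ < _ + X]SE LE.
have {}hY : - (e / 4) < \sum_kappa residual fam T kappa * ent Y kappa by exact: hY.
have {}gG : r - e / 2 < a * linear_form g u + b * quadratic_form G u by exact: gG.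
move: (\sum_kappa _) hY (a * _ + _) gG e0 => z hz y hy e0'.
clear - hz hy e0'; lra.
Unshelve. all: by end_near.
Qed.

(** The test direction is [x] itself, where the noise is a single Gaussian of variance [2 / n]. This
    covers a maximizer of the objective at an endpoint, where [a] or [b] degenerates. *)
Lemma spiked_value_spike d (lambda : R) : (1 <= d)%N ->
  forall e del, 0 < e -> 0 < del -> exists N, forall n, (N <= n)%N ->
  forall x : n.-tuple R, unit_sphere n x ->
  ((1 - del)%:E <= gaussian_tensor d n [set W |
    exists2 v, unit_vec v & (lambda - e < spiked_value lambda x W v)%R])%E.
Proof.
move=> d1 e del e0 del0.
have [v1 v1_gt0 tail] := gaussian_linear_tail_small e0 del0.
exists (Num.truncn (2 / v1)).+1 => -[//|n] nN x Sx.
set v := 2 / n.+1%:R : R.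
have v0 : 0 < v by rewrite divr_gt0.
have vle : v <= v1.
  rewrite /v ler_pdivrMr// mulrC -ler_pdivrMr//; apply: ltW.
  by apply: (lt_le_trans (truncnS_gt _)); rewrite ler_nat.
have {}tail := tail v; rewrite v0 vle in tail; have {}tail := tail isT.
pose T (kappa : multi_index d n.+1) := \prod_(k < d) tnth x (kappa k).
have T1 : \sum_kappa T kappa ^+ 2 = 1.
  transitivity (\sum_(kappa : multi_index d n.+1) \prod_(k < d) tnth x (kappa k) ^+ 2).
    by apply: eq_bigr => kappa _; rewrite /T -prodrXl.
  rewrite -(bigA_distr_bigA (fun (k : 'I_d) i => tnth x i ^+ 2)).
  by apply: big1 => k _; exact: Sx.
apply: (le_trans (tail _ T _)); first by rewrite T1.
apply: le_measure; rewrite ?inE.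
- exact: measurable_linear_event.
- exact: measurable_spiked_value.
move=> W hW; exists (tnth x) => //.
rewrite /spiked_value (_ : \sum_i _ = 1); last by rewrite -[RHS]Sx; apply: eq_bigr => i _; rewrite expr2.
rewrite expr1n mulr1 ltrD2l; under eq_bigr do rewrite mulrC; exact: hW.
Qed.

Lemma spiked_value_ge_L d (lambda : R) : (3 <= d)%N -> 0 <= lambda ->
  forall e del, 0 < e -> 0 < del -> exists N, forall n, (N <= n)%N ->
  forall x : n.-tuple R, unit_sphere n x ->
  ((1 - del)%:E <= gaussian_tensor d n [set W |
    exists2 v, unit_vec v & (L d lambda - e < spiked_value lambda x W v)%R])%E.
Proof.
move=> d3 l0 e del e0 del0; have [m m01 [-> _]] := L_max lambda d3.
move: m01; rewrite in_itv /= => /andP[m0 m1].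
have [mm|] := boolP (0 < m < 1).
  by apply: spiked_value_lower_bound => //; lia.
rewrite negb_and -!leNgt => mm.
have mE : m = 0 \/ m = 1.
  by case/orP: mm => h; [left|right]; apply/eqP; rewrite eq_le ?h ?m0 ?m1.
have Ll : L_objective d lambda m <= lambda by apply: L_objective_le0 => //; lia.
have [N HN] := @spiked_value_spike d lambda ltac:(lia) e del e0 del0.
exists N => n nN x Sx; apply: (le_trans (HN n nN x Sx)).
apply: le_measure; rewrite ?inE; try exact: measurable_spiked_value.
by move=> W [v v1 hv]; exists v => //; lra.
Qed.

End spiked.

(** * Passage to the injective norm and to a random spike *)

Section transfer.
Context (R : realType).

(** Permuting the slots of an index leaves the entries of a pure power unchanged, so every
    permutation contributes the same sum. *)
Lemma tensor_inner_symmetrize d n (W : tensor R d n) (v : n.-tuple R) :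
  tensor_inner (symmetrize W) (tensor_pow d v) = tensor_inner W (tensor_pow d v).
Proof.
rewrite /tensor_inner.
under eq_bigr do rewrite entry_mk_tensor -mulrA mulr_suml.
rewrite -mulr_sumr exchange_big.
transitivity ((d`!%:R)^-1 * \sum_(s : {perm 'I_d}) \sum_(i : multi_index d n)
    entry W i * entry (tensor_pow d v) i).
  congr (_ * _); apply: eq_bigr => s _.
  rewrite [RHS](reindex_inj (h := fun i : multi_index d n => [ffun k => i (s k)])).
    apply: eq_bigr => i _; congr (_ * _); rewrite /tensor_pow !entry_mk_tensor.
    rewrite (reindex_inj (@perm_inj _ s)); apply: eq_bigr => k _.
    by rewrite ffunE.
  move=> i j /ffunP ij; apply/ffunP => k; have := ij ((s^-1)%g k).
  by rewrite !ffunE permKV.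
rewrite sumr_const -[(\sum_(i : multi_index d n) _) *+ _]mulr_natl card_Sn mulKf//.
Qed.

Lemma tensor_inner_spike d n (lambda : R) (x v : n.-tuple R) (W : tensor R d n) :
  tensor_inner (spike lambda (x, symmetrize W)) (tensor_pow d v) =
  spiked_value lambda x W (tnth v).
Proof.
rewrite /tensor_inner /spiked_value.
under eq_bigr do rewrite entry_mk_tensor mulrDl -mulrA.
rewrite big_split /= -mulr_sumr; congr (_ * _ + _).
  transitivity (\sum_(i : multi_index d n) \prod_(k < d) (tnth x (i k) * tnth v (i k))).
    by apply: eq_bigr => i _; rewrite big_split; congr (_ * _); exact: entry_mk_tensor.
  by rewrite -(bigA_distr_bigA (fun (k : 'I_d) i => tnth x i * tnth v i)) prodr_const card_ord.
rewrite -[LHS]/(tensor_inner (symmetrize W) (tensor_pow d v)) tensor_inner_symmetrize.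
by apply: eq_bigr => kappa _; rewrite entry_mk_tensor.
Qed.

(** A weak threshold is a countable intersection of strict thresholds [c - 1 / (k + 1)], each of
    which is a sphere event; attainment of the maximum for [0 < n] links these to [inj_norm]. *)
Lemma measurable_inj_norm_ge d n (c : R) : (0 < n)%N ->
  measurable [set T : tensor R d n | c <= inj_norm T].
Proof.
move=> n0.
pose phi (T : tensor R d n) (v : 'I_n -> R) := \sum_(i : multi_index d n) ent T i * \prod_(k < d) v (i k).
have phiE (T : tensor R d n) (v : n.-tuple R) : tensor_inner T (tensor_pow d v) = phi T (tnth v).
  by apply: eq_bigr => i _; rewrite entry_mk_tensor.
rewrite (_ : [set T | _] = \bigcap_k [set T : tensor R d n |
    exists2 v, unit_vec v & c - k.+1%:R^-1 < phi T v]).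
  apply: bigcapT_measurable => k; apply: measurable_sphere_event => [v|T w v wv].
    by apply: measurable_sum => i; apply: measurable_funM => //; exact: measurable_ent.
  apply: cvg_finsum => i; apply: cvgM; first exact: cvg_cst.
  by apply: cvg_finprod => k'; exact: wv.
apply/seteqP; split => T /=; have [v Sv [-> vmax]] := inj_norm_max T n0.
  move=> cT k _; exists (tnth v); first exact: Sv.
  by rewrite -phiE; apply: lt_le_trans cT; rewrite ltrBlDr ltrDl invr_gt0.
move=> h; rewrite leNgt; apply/negP => lt.
have := h (Num.truncn (c - tensor_inner T (tensor_pow d v))^-1) I.
move=> [u u1]; have uE : u = tnth [tuple u i | i < n].
  by apply/funext => i; rewrite tnth_mktuple.
have : unit_sphere n [tuple u i | i < n].
  by rewrite /unit_sphere /= -[RHS]u1; apply: eq_bigr => i _; rewrite tnth_mktuple.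
have phiu : phi T u = tensor_inner T (tensor_pow d [tuple u i | i < n]).
  by rewrite phiE -uE.
move=> /vmax; rewrite phiu => le1 lt1.
set y := c - tensor_inner T (tensor_pow d v) in lt1.
have y0 : 0 < y by rewrite subr_gt0.
have [z zy lt2] : exists2 z, z < y & c - z < tensor_inner T (tensor_pow d [tuple u i | i < n]).
  exists (Num.truncn y^-1).+1%:R^-1 => //.
  by rewrite -[ltRHS]invrK ltf_pV2 ?posrE ?invr_gt0//; exact: truncnS_gt.
by move: zy; rewrite /y; lra.
Qed.

Lemma spiked_wigner_ge d (lambda : R) (X : forall n : nat, probability (n.-tuple R) R) :
  (3 <= d)%N -> 0 <= lambda ->
  (forall n : nat, (0 < n)%N -> X n (unit_sphere n) = 1%E) ->
  forall e, 0 < e -> exists N, forall n, (N <= n)%N ->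
  ((1 - e)%:E <= spiked_wigner d n lambda (X n)
    [set T | (L d lambda - e <= inj_norm T)%R])%E.
Proof.
move=> d3 l0 hX e e0.
(* The cap 1/2 keeps the section error at most 1, as the Fubini bound demands. *)
pose e1 := Num.min (e / 2) (1 / 2).
have e10 : 0 < e1 by rewrite lt_min !divr_gt0.
have e11 : e1 <= e / 2 by rewrite ge_min lexx.
have e12 : e1 <= 1 / 2 by rewrite ge_min lexx orbT.
have [N HN] := spiked_value_ge_L d3 l0 e0 e10.
exists N.+1 => -[//|n] nN.
set S := [set T | _].
have mS : measurable S by exact: measurable_inj_norm_ge.
have mU : measurable (unit_sphere n.+1 : set (n.+1.-tuple R)).
  have -> : unit_sphere n.+1 = [set v : n.+1.-tuple R | dot v v <= 1] `&` ~` [set v | dot v v < 1].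
    apply/seteqP; split => v; rewrite /unit_sphere /= /dot.
      by under eq_bigr do rewrite expr2; move=> ->; rewrite lexx ltxx.
    move=> [h1 /negP]; rewrite -leNgt => h2.
    by under eq_bigr do rewrite expr2; apply/eqP; rewrite eq_le h1 h2.
  apply: measurableI; first exact: measurable_le_event (@measurable_dot _ n.+1).
  apply: measurableC.
  have -> : [set v : n.+1.-tuple R | dot v v < 1] = [set v | - 1 < - dot v v].
    by apply/seteqP; split => v /=; rewrite ltrN2.
  by apply: measurable_gt_event; apply: measurable_funN; exact: measurable_dot.
have mspS : measurable (spike lambda @^-1` S : set (n.+1.-tuple R * tensor R d n.+1)).
  by rewrite -[X in measurable X]setTI; exact: measurable_spike.
rewrite /spiked_wigner /distribution /pushforward.
apply: (@le_trans _ _ (1 - (e1 + e1))%:E); first by rewrite lee_fin; lra.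
apply: (@product_probability_ge _ _ _ _ _ _ _ (unit_sphere n.+1)) => //.
- exact: ltW.
- by rewrite ltW//=; lra.
- by rewrite hX// lee_fin; lra.
move=> x Sx; apply: (le_trans (HN n.+1 (ltnW nN) x Sx)).
rewrite /wigner /distribution /pushforward.
apply: le_measure; rewrite ?inE.
- exact: measurable_spiked_value.
- rewrite -[X in measurable X]setTI; apply: measurable_symmetrize => //.
  exact: measurable_xsection.
move=> W [u u1 hu]; rewrite /xsection /= inE /S /=.
have [v Sv [-> vmax]] := inj_norm_max (spike lambda (x, symmetrize W)) (ltn0Sn n).
have uE : u = tnth [tuple u i | i < n.+1].
  by apply/funext => i; rewrite tnth_mktuple.
have : unit_sphere n.+1 [tuple u i | i < n.+1].
  by rewrite /unit_sphere /= -[RHS]u1; apply: eq_bigr => i _; rewrite tnth_mktuple.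
move=> /vmax; apply: le_trans; rewrite tensor_inner_spike -uE; exact: ltW.
Qed.

End transfer.

(* [eps n] is [1 / k.+1] for the largest [k <= n] whose threshold is at most [n]. *)
Lemma diagonal_rate (R : realType) (P : nat -> R -> Prop) :
  (forall e, 0 < e -> exists N, forall n, (N <= n)%N -> P n e) ->
  exists eps : nat -> R, eps n @[n --> \oo] --> (0 : R) /\
    \forall n \near \oo, P n (eps n).
Proof.
move=> H.
have HN k := cid (H k.+1%:R^-1 ltac:(by rewrite invr_gt0)).
pose N k := projT1 (HN k).
have NP k n : (N k <= n)%N -> P n k.+1%:R^-1 by exact: (projT2 (HN k)).
pose good n k := (N k <= n)%N.
pose kap n := \max_(k < n.+1 | good n k) k.
have kapP n : (N 0 <= n)%N -> good n (kap n).
  move=> h; rewrite /kap; apply: (big_ind (good n)) => // x y gx gy.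
  by rewrite /maxn; case: ifP.
exists (fun n => (kap n).+1%:R^-1); split; last first.
  by exists (N 0) => // n /= h; apply: NP; exact: kapP.
apply/cvgrPdist_lt => e e0.
exists (maxn (Num.truncn e^-1) (N (Num.truncn e^-1))) => // n /=; rewrite geq_max => /andP[h1 h2].
rewrite sub0r normrN gtr0_norm ?invr_gt0//.
have le : (Num.truncn e^-1 <= kap n)%N.
  have hlt : (Num.truncn e^-1 < n.+1)%N by rewrite ltnS.
  exact: (leq_bigmax_cond (Ordinal hlt)).
rewrite -[ltRHS]invrK ltf_pV2 ?posrE ?invr_gt0//.
by apply: (lt_le_trans (truncnS_gt _)); rewrite ler_nat ltnS.
Qed.

Theorem theorem3p4 (R : realType) (d : nat) (hd : (3 <= d)%N)
    (lambda : R) (hlambda : 0 <= lambda)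
    (X : forall n : nat, probability (n.-tuple R) R)
    (hX : forall n : nat, (0 < n)%N -> X n (unit_sphere n) = 1%E) :
  exists eps : nat -> R,
    eps n @[n --> \oo] --> (0 : R) /\
    spiked_wigner d n lambda (X n)
      [set T | L d lambda - eps n <= inj_norm T] @[n --> \oo] --> (1%E : \bar R).
Proof.
have [eps [eps0 Heps]] := diagonal_rate (spiked_wigner_ge hd hlambda hX).
exists eps; split => //.
(* The rate serves twice: as the loss in the norm and as the bound on the failure probability. *)
have h : (1 - eps n)%:E @[n --> \oo] --> (1%E : \bar R).
  apply/fine_cvgP; split; first exact: nearW.
  by rewrite -[X in _ --> X]subr0; apply: cvgB; [exact: cvg_cst|exact: eps0].
apply: (squeeze_cvge _ h (cvg_cst (1%E : \bar R))).
near=> n; apply/andP; split; first by near: n.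
apply: probability_le1; apply: measurable_inj_norm_ge.
by near: n; exact: nbhs_infty_gt.
Unshelve. all: by end_near.
Qed.
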